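(* Let $X$ be a separable real Banach space. (I) (The $\ell_1$ case.) The following are equivalent: (1) $X$ contains a subspace isomorphic to $\ell_1$. (2) For every equivalent norm $|||\cdot|||$ on $X$ there exists a $|||\cdot|||$-normalized sequence in $X$ having a spreading model $(e_n)$ which is $1$-equivalent to the unit vector basis of $\ell_1$. (3) For every equivalent norm $|||\cdot|||$ on $X$ there exists a $|||\cdot|||$-normalized sequence in $X$ having a spreading model $(e_n)$ satisfying $|||e_1+e_2|||=|||e_1-e_2|||=2$. (II) (The $c_0$ case.) The following are equivalent: (1) $X$ contains a subspace isomorphic to $c_0$. (2) For every equivalent norm $|||\cdot|||$ on $X$ there exists a $|||\cdot|||$-normalized sequence in $X$ having a spreading model $(e_n)$ which is $1$-equivalent to the unit vector basis of $c_0$. (3) For every equivalent norm $|||\cdot|||$ on $X$ there exists a $|||\cdot|||$-normalized weakly null sequence in $X$ having a spreading model $(e_n)$ satisfying $|||e_1+e_2|||=1$.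
   Context: Spreading model: let $(X,|||\cdot|||)$ be a Banach space and $(y_n)\subseteq X$ a bounded sequence such that for all $k\in\mathbb N$ and $a_1,\dots,a_k\in\mathbb R$ the iterated limit $$f(a_1,\dots,a_k)=\lim_{n_1\to\infty}\cdots\lim_{n_k\to\infty}\Big|\Big|\Big|\sum_{i=1}^k a_iy_{n_i}\Big|\Big|\Big|$$ exists. Suppose $(y_n)$ does not converge in norm and does not converge weakly to a nonzero element of $X$. Then $f$ defines a norm on $c_{00}$ (finitely supported real sequences), again denoted $|||\cdot|||$, and the unit vector basis $(e_i)$ of $c_{00}$, as a basis of the completion of $c_{00}$ under this norm, is called the spreading model of $(y_n)$. (Every bounded sequence has a subsequence for which all these iterated limits exist.) Two sequences $(u_i)$, $(v_i)$ in Banach spaces are $K$-equivalent if there are $A,B>0$ with $AB\le K$ such that $A^{-1}\|\sum a_iu_i\|\le\|\sum a_iv_i\|\le B\|\sum a_iu_i\|$ for all finitely supported real $(a_i)$. *)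

(* Defs.v *)
From HB Require Import structures.
From mathcomp Require Import all_boot all_order all_algebra.
From mathcomp Require Import all_classical all_reals all_analysis.

Set Implicit Arguments.
Unset Strict Implicit.
Unset Printing Implicit Defensive.

Import Order.TTheory GRing.Theory Num.Theory numFieldNormedType.Exports.

Local Open Scope classical_set_scope.
Local Open Scope ring_scope.

(* R^o is used because pointwise scaling makes nat -> R^o, not nat -> R,
   an lmodType R. *)
Definition unit_vec (R : realType) (i : nat) : nat -> R^o :=
  fun n => (n == i)%:R.

Section L1.
Variable R : realType.

Definition l1_pred : {pred nat -> R^o} :=
  fun a => `[< cvgn [normed series a] >].

Lemma l1_submod : submod_closed l1_pred.
Proof.
split.
  rewrite unfold_in; apply/asboolP; apply: (cvgP (0 : R)).
  rewrite (_ : [normed series _] = cst 0); first exact: cvg_cst.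
  apply/funext => n; rewrite /series/=; apply: big1_seq => i _.
  exact: normr0.
move=> k a b; rewrite !unfold_in => /asboolP ha /asboolP hb; apply/asboolP.
apply: (@series_le_cvg _ _ (`|k| *: (fun n => `|a n|) + (fun n => `|b n|) : nat -> R^o)).
- by move=> n; exact: normr_ge0.
- by move=> n; rewrite addr_ge0// mulr_ge0.
- by move=> n; rewrite (le_trans (ler_normD _ _))// normrM.
- by apply: is_cvg_seriesD => //; exact: is_cvg_seriesZ.
Qed.

HB.instance Definition _ :=
  GRing.isSubmodClosed.Build R (nat -> R^o) l1_pred l1_submod.

Record l1 := L1 { l1_val :> nat -> R^o ; l1_valP : l1_val \in l1_pred }.

HB.instance Definition _ := [isSub for l1_val].
HB.instance Definition _ := [Choice of l1 by <:].
HB.instance Definition _ := [SubChoice_isSubLmodule of l1 by <:].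

Definition l1_norm (a : l1) : R := limn [normed series a].

Lemma l1_cvg (a : l1) : cvgn [normed series a].
Proof. by apply/asboolP; exact: (l1_valP a). Qed.

Lemma l1_norm_ge (a : l1) n : `|a n| <= l1_norm a.
Proof.
apply: (@le_trans _ _ ([normed series a] n.+1)).
  rewrite -[leRHS]/(series (fun k => `|a k| : R) n.+1) seriesSr lerDr.
  by apply: sumr_ge0 => i _; exact: normr_ge0.
apply: nondecreasing_cvgn_le; last exact: l1_cvg.
by apply: nondecreasing_series => *; exact: normr_ge0.
Qed.

Lemma l1_normD (a b : l1) : l1_norm (a + b) <= l1_norm a + l1_norm b.
Proof.
rewrite /l1_norm -lim_seriesD; [|exact: l1_cvg|exact: l1_cvg].
apply: lim_series_le; first exact: l1_cvg.
- by apply: is_cvg_seriesD; exact: l1_cvg.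
- by move=> n; exact: ler_normD.
Qed.

Lemma l1_normZ k (a : l1) : l1_norm (k *: a) = `|k| * l1_norm a.
Proof.
rewrite /l1_norm -[RHS](@lim_seriesZ R); last exact: l1_cvg.
by congr (limn (series _)); apply/funext => n; rewrite /= normrM.
Qed.

Lemma l1_norm_eq0 (a : l1) : l1_norm a = 0 -> a = 0.
Proof.
move=> a0; apply/val_inj/funext => n; apply/eqP.
by rewrite -normr_le0 -a0; exact: l1_norm_ge.
Qed.

HB.instance Definition _ :=
  Lmodule_isNormed.Build R l1 l1_normD l1_normZ l1_norm_eq0.

Lemma unit_vec_l1 i : unit_vec R i \in l1_pred.
Proof.
rewrite unfold_in; apply/asboolP/(cvgP (1 : R)).
apply: cvg_near_cst; near=> n.
have ni : (i < n)%N by near: n; exists i.+1.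
rewrite -[LHS]/(series (fun k => `|unit_vec R i k| : R) n) seriesEnat/=.
rewrite (bigD1_seq i) ?mem_index_iota ?iota_uniq//= /unit_vec eqxx.
by rewrite normr1 big1 ?addr0// => j /negbTE ->; rewrite normr0.
Unshelve. all: by end_near. Qed.

Definition l1_basis (i : nat) : l1 := L1 (unit_vec_l1 i).

End L1.

Section C0.
Variable R : realType.

Definition c0_pred : {pred nat -> R^o} :=
  fun a => `[< a n @[n --> \oo] --> (0 : R) >].

Lemma c0_submod : submod_closed c0_pred.
Proof.
split; first by rewrite unfold_in; apply/asboolP; exact: cvg_cst.
move=> k a b; rewrite !unfold_in => /asboolP ha /asboolP hb; apply/asboolP.
rewrite -[X in _ --> X](addr0 (0 : R)); apply: cvgD => //.
by rewrite -[X in _ --> X](mulr0 k); apply: cvgMr.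
Qed.

HB.instance Definition _ :=
  GRing.isSubmodClosed.Build R (nat -> R^o) c0_pred c0_submod.

Record c0 := C0 { c0_val :> nat -> R^o ; c0_valP : c0_val \in c0_pred }.

HB.instance Definition _ := [isSub for c0_val].
HB.instance Definition _ := [Choice of c0 by <:].
HB.instance Definition _ := [SubChoice_isSubLmodule of c0 by <:].

Definition c0_norm (a : c0) : R := sup (range (fun n => `|a n|)).

Lemma c0_has_sup (a : c0) : has_sup (range (fun n => `|a n|)).
Proof.
split; first by exists `|a 0%N|, 0%N.
have /asboolP ha : `[< a n @[n --> \oo] --> (0 : R) >] by exact: c0_valP.
have /cvg_seq_bounded/bounded_fun_has_ubound [M hM] :
  cvgn ((fun n => `|a n|) : nat -> R).
  by apply: is_cvg_norm; exact: cvgP ha.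
by exists M.
Qed.

Lemma c0_norm_ge (a : c0) n : `|a n| <= c0_norm a.
Proof. by apply: sup_upper_bound; [exact: c0_has_sup|exists n]. Qed.

Lemma c0_norm_le (a : c0) (M : R) :
  (forall n, `|a n| <= M) -> c0_norm a <= M.
Proof.
move=> aM; apply: ge_sup; first by exists `|a 0%N|, 0%N.
by move=> _ [n _ <-].
Qed.

Lemma c0_normD (a b : c0) : c0_norm (a + b) <= c0_norm a + c0_norm b.
Proof.
apply: c0_norm_le => n; rewrite (le_trans (ler_normD _ _))// lerD//;
  exact: c0_norm_ge.
Qed.

Lemma c0_normZ k (a : c0) : c0_norm (k *: a) = `|k| * c0_norm a.
Proof.
have le l (b : c0) : c0_norm (l *: b) <= `|l| * c0_norm b.
  apply: c0_norm_le => n; rewrite [`|_|]normrM ler_wpM2l//.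
  exact: c0_norm_ge.
apply/eqP; rewrite eq_le le/=.
have [->|k0] := eqVneq k 0.
  by rewrite normr0 mul0r (le_trans _ (c0_norm_ge _ 0%N)).
rewrite -ler_pdivlMl ?normr_gt0// -normfV.
by rewrite -[X in c0_norm X <= _](scalerK k0); exact: le.
Qed.

Lemma c0_norm_eq0 (a : c0) : c0_norm a = 0 -> a = 0.
Proof.
move=> a0; apply/val_inj/funext => n; apply/eqP.
by rewrite -normr_le0 -a0; exact: c0_norm_ge.
Qed.

HB.instance Definition _ :=
  Lmodule_isNormed.Build R c0 c0_normD c0_normZ c0_norm_eq0.

Lemma unit_vec_c0 i : unit_vec R i \in c0_pred.
Proof.
rewrite unfold_in; apply/asboolP; apply: cvg_near_cst; near=> n.
have ni : (i < n)%N by near: n; exists i.+1.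
by rewrite /unit_vec gtn_eqF.
Unshelve. all: by end_near. Qed.

Definition c0_basis (i : nat) : c0 := C0 (unit_vec_c0 i).

End C0.

Definition separable (T : topologicalType) : Prop :=
  exists D : set T, countable D /\ dense D.

(* T is an isomorphism of E onto the subspace range T of X. *)
Definition contains_isomorphic (R : realType) (X E : normedModType R) : Prop :=
  exists (T : {linear E -> X}) (A B : R),
    [/\ 0 < A, 0 < B & forall a : E, A * `|a| <= `|T a| <= B * `|a|].

Definition equivalent_norm (R : realType) (X : normedModType R) (N : X -> R)
    : Prop :=
  [/\ forall x y, N (x + y) <= N x + N y,
      forall (k : R) x, N (k *: x) = `|k| * N x,
      forall x, N x = 0 -> x = 0 &
      exists A B : R,
        [/\ 0 < A, 0 < B & forall x, A * `|x| <= N x <= B * `|x|]].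

Definition normalized (R : realType) (X : normedModType R) (N : X -> R)
    (y : nat -> X) : Prop := forall n, N (y n) = 1.

Definition weakly_cvg (R : realType) (X : normedModType R) (y : nat -> X)
    (x : X) : Prop :=
  forall phi : {linear X -> R^o}, continuous phi ->
    phi (y n) @[n --> \oo] --> phi x.

(* For a = [:: a_1; ...; a_k], the iterated limit
   lim_{n_1} ... lim_{n_k} N (x + \sum_i a_i y_{n_i}) exists and equals l. *)
Fixpoint iterated_lim (R : realType) (X : normedModType R) (N : X -> R)
    (y : nat -> X) (a : seq R) (x : X) (l : R) : Prop :=
  if a is a1 :: a' then
    exists g : nat -> R,
      (forall n, iterated_lim N y a' (x + a1 *: y n) (g n)) /\
      g n @[n --> \oo] --> l
  else l = N x.

(* c_00 is represented by {poly R}, whose elements are the finitely supported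
   coefficient sequences; indices start at 0, so e_1, e_2, ... are c00_basis 0,
   c00_basis 1, ... *)
Notation c00 R := {poly R}.

Definition c00_basis (R : realType) (i : nat) : c00 R := 'X^i.

(* f is the norm on c_00 of the spreading model of y; the spreading model
   itself is the sequence c00_basis R in (c_00, f).  Poly a is the element
   \sum_i a_i e_i of c_00.  Boundedness and convergence do not depend on the
   choice of an equivalent norm, so they are stated for the norm of X. *)
Definition spreading_model (R : realType) (X : normedModType R) (N : X -> R)
    (y : nat -> X) (f : c00 R -> R) : Prop :=
  [/\ bounded_fun y,
      ~ cvgn y,
      ~ (exists2 x : X, x != 0 & weakly_cvg y x) &
      forall a : seq R, iterated_lim N y a 0 (f (Poly a))].

Definition K_equivalent (R : realType) (K : R)
    (U : lmodType R) (NU : U -> R) (u : nat -> U)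
    (V : lmodType R) (NV : V -> R) (v : nat -> V) : Prop :=
  exists A B : R, [/\ 0 < A, 0 < B, A * B <= K &
    forall (n : nat) (a : nat -> R),
      A^-1 * NU (\sum_(i < n) a i *: u i) <= NV (\sum_(i < n) a i *: v i)
        <= B * NU (\sum_(i < n) a i *: u i)].

(* Main.v *)
From HB Require Import structures.
Require Import Defs.
From mathcomp Require Import all_boot all_order all_algebra.
From mathcomp Require Import all_classical all_reals all_analysis.
From mathcomp Require Import ring lra.

Set Implicit Arguments.
Unset Strict Implicit.
Unset Printing Implicit Defensive.

Import Order.TTheory GRing.Theory Num.Theory numFieldNormedType.Exports.

Local Open Scope classical_set_scope.
Local Open Scope ring_scope.

(** (1) implies (2): by James' distortion argument, far out in a copy of l1 (c0)
    there are blocks that are N-normalized and almost isometrically equivalent to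
    the unit vector basis; a diagonal argument extracts a subsequence along which
    all the iterated limits exist.

    (3) implies (1): let (d_q) be dense in X and let N be the sum over q of
    c_q (| |x| d_q + x | + | |x| d_q - x |).  All the terms are convex, so that the
    hypothesis on the spreading model for N, an equality case of the triangle
    inequality (of weak lower semicontinuity for c0), holds termwise and gives,
    with tau(p, a) = lim_n |p + a y_n| and for all p in X,
      lim_m lim_n |p + e y_m + f y_n| >= (tau(p, 2 e) + tau(p, 2 f)) / 2
    for all signs e, f (l1 case), resp.
      lim_m lim_n |p + y_m + y_n| <= tau(p, 1)
    (c0 case).  These limits are uniform over p in a compact set, so that a
    subsequence can be chosen greedily with summable errors; it is equivalent to
    the unit vector basis of l1 (c0).  Limits of bounded sequences are taken along
    a free ultrafilter. *)

(** A condition on two basis vectors has to control combinations of every length. This is why the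
    limit inequalities are wanted for every [p] in [X]: with [p] the partial sum built so far, the
    same inequality serves each further term. The factor $|x|$ in front of $d_q$ makes each term of
    [N] positively homogeneous; along the sequence it tends to $\lambda = \lim |y_n| > 0$, and the
    multiples $\lambda d_q$ are again dense.

    An equality for [N] passes to a single term because [N] minus this term is still sublinear. A
    term involves both $p$ and $-p$; the two are separated by an opposite inequality valid for each
    alone, the triangle inequality for l1 and weak lower semicontinuity for c0.

    In the l1 case the signs $e$ and $f$ may differ, so that only the minimum of $\tau(p, s)$ and
    $\tau(p, -s)$ survives an iteration. In the c0 case the inequality concerns nonnegative
    coefficients, and signs are treated afterwards by splitting a combination. *)

(** * The Hahn-Banach theorem under a cone of constraints *)

Section HahnBanach.
Variables (R : realType) (X : lmodType R).
Implicit Types (p q : X -> R) (K : set (X * R)).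

Definition sublinear p := (forall x y, p (x + y) <= p x + p y) /\
  (forall t x, 0 <= t -> p (t *: x) = t * p x).

Lemma sublinear0 p : sublinear p -> p 0 = 0.
Proof. by move=> [_ /(_ 0 0 (lexx 0))]; rewrite scale0r mul0r. Qed.

Lemma sublinearN p x : sublinear p -> - p (- x) <= p x.
Proof.
move=> sp; have := sp.1 x (- x).
by rewrite subrr (sublinear0 sp); lra.
Qed.

(** The opposite inequality for [t *: x] is the assumed one for the factor [t^-1]. *)
Lemma is_sublinear p : (forall x y, p (x + y) <= p x + p y) ->
  (forall t x, 0 < t -> p (t *: x) <= t * p x) -> p 0 = 0 -> sublinear p.
Proof.
move=> pD pZ p0; split=> // t x; rewrite le_eqVlt => /predU1P[<-|t0].
  by rewrite scale0r mul0r.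
apply/eqP; rewrite eq_le pZ//= mulrC -ler_pdivlMr// mulrC.
rewrite -{1}(@scalerK _ _ t _ x) ?gt_eqF//; apply: pZ; rewrite invr_gt0//.
Qed.

(* An element (v, s) of K stands for the constraint phi v <= s on a functional. *)
Definition cone K := [/\ K (0, 0),
  forall v s w t, K (v, s) -> K (w, t) -> K (v + w, s + t) &
  forall v s t, 0 < t -> K (v, s) -> K (t *: v, t * s)].

(** The infimal convolution: [q z] is the infimum of [p (z - v) + s] over the constraints [(v, s)]
    of [K]. The hypothesis on [p] and [K] keeps it above [- p (- z)]. A linear functional below [q]
    satisfies all the constraints together with the bound [p]. *)
Lemma cone_sublinear p K : sublinear p -> cone K ->
    (forall v s, K (v, s) -> 0 <= p (- v) + s) ->
  exists q, [/\ sublinear q, forall x, q x <= p x &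
                forall v s, K (v, s) -> q v <= s].
Proof.
move=> sp [K0 KD KZ] pK.
pose S z := [set p (z - u.1) + u.2 | u in K].
have S0 z : S z !=set0 by exists (p (z - 0) + 0), (0, 0).
have lb z : lbound (S z) (- p (- z)).
  move=> _ [[v s] /= /pK + <-].
  have := sp.1 (z - v) (- z); rewrite addrAC subrr add0r; lra.
have iS z v s : K (v, s) -> inf (S z) <= p (z - v) + s.
  by move=> Kvs; apply: ge_inf; [exists (- p (- z))|exists (v, s)].
exists (fun z => inf (S z)); split.
- apply: is_sublinear.
  + move=> x y; rewrite -lerBlDr; apply: lb_le_inf => // _ [[v s] /= Kv <-].
    rewrite lerBlDr -lerBlDl; apply: lb_le_inf => // _ [[w t] /= Kw <-].
    rewrite lerBlDl; apply: (le_trans (iS _ _ _ (KD _ _ _ _ Kv Kw))).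
    have := sp.1 (x - v) (y - w); rewrite addrACA -opprD; lra.
  + move=> t x t0; rewrite mulrC -ler_pdivrMr//.
    apply: lb_le_inf => // _ [[v s] /= Kv <-].
    rewrite ler_pdivrMr//; apply: (le_trans (iS _ _ _ (KZ _ _ _ t0 Kv))).
    by rewrite /= -scalerBr sp.2 -?mulrDr ?(ltW t0)// mulrC.
  + apply/eqP; rewrite eq_le; apply/andP; split.
      by have := iS 0 _ _ K0; rewrite /= subr0 addr0 (sublinear0 sp).
    by apply: lb_le_inf => // _ [[v s] /= Kv <-]; rewrite sub0r; exact: pK.
- by move=> x; have := iS x _ _ K0; rewrite /= subr0 addr0.
- move=> v s Kv; have := iS v _ _ Kv.
  by rewrite subrr (sublinear0 sp) add0r.
Qed.

Lemma cone_ray x (c : R) : cone [set (t *: x, t * c) | t in [set t | 0 <= t]].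
Proof.
split; first by exists 0; rewrite //= scale0r mul0r.
- move=> _ _ _ _ [t /= t0 [<- <-]] [u /= u0 [<- <-]].
  by exists (t + u); rewrite ?scalerDl ?mulrDl//= addr_ge0.
- move=> _ _ t t0 [u /= u0 [<- <-]].
  by exists (t * u); rewrite ?scalerA ?mulrA//= mulr_ge0// ltW.
Qed.

Lemma minimal_sublinear p : sublinear p ->
  exists q, [/\ sublinear q, forall x, q x <= p x &
    forall q', sublinear q' -> (forall x, q' x <= q x) -> q' = q].
Proof.
move=> sp.
pose T := {q : X -> R | sublinear q /\ forall x, q x <= p x}.
(* The order is reversed, so that a maximal element for [r] is a pointwise minimal function. *)
pose r (u v : T) := `[< forall x, sval v x <= sval u x >].
have [|u v w|u v||[q [sq qp]] qmin] := @Zorn T r.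
- by move=> u; exact/asboolP.
- by move=> /asboolP uv /asboolP vw; apply/asboolP => x; exact: le_trans (uv x).
- move: u v => [u hu] [v hv] /asboolP/= uv /asboolP/= vu.
  have e : u = v by apply/funext => x; apply/eqP; rewrite eq_le uv vu.
  by case: _ / e hv {uv vu} => hv; congr exist; exact: Prop_irrelevance.
- move=> A Atot; have [[u0 Au0]|A0] := pselect (exists u, A u); last first.
    exists (exist _ p (conj sp (fun x => lexx (p x)))) => u Au.
    by case: A0; exists u.
  pose S x := [set sval u x | u in A].
  have S0 x : S x !=set0 by exists (sval u0 x), u0.
  have lb x : lbound (S x) (- p (- x)).
    move=> _ [u Au <-]; have [su up] := svalP u.
    by have := sublinearN x su; have := up (- x); lra.
  have iS x u : A u -> inf (S x) <= sval u x.
    by move=> Au; apply: ge_inf; [exists (- p (- x))|exists u].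
  have sI : sublinear (fun x => inf (S x)).
    apply: is_sublinear.
    + move=> x y; rewrite -lerBlDr; apply: lb_le_inf => // _ [u Au <-].
      rewrite lerBlDr -lerBlDl; apply: lb_le_inf => // _ [v Av <-].
      (* Of two members of the chain, the smaller one serves for both arguments. *)
      rewrite lerBlDl; have [/asboolP uv|/asboolP vu] := Atot _ _ Au Av.
      * apply: (le_trans (iS _ _ Av)); have := (svalP v).1.1 x y.
        by have := uv x; lra.
      * apply: (le_trans (iS _ _ Au)); have := (svalP u).1.1 x y.
        by have := vu y; lra.
    + move=> t x t0; rewrite mulrC -ler_pdivrMr//.
      apply: lb_le_inf => // _ [u Au <-]; rewrite ler_pdivrMr//.
      by rewrite mulrC -(svalP u).1.2 ?(ltW t0)//; exact: iS.
    + apply/eqP; rewrite eq_le; apply/andP; split.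
        by have := iS 0 _ Au0; rewrite (sublinear0 (svalP u0).1).
      apply: lb_le_inf => // _ [u Au <-].
      by rewrite (sublinear0 (svalP u).1).
  have pI x : inf (S x) <= p x.
    exact: (le_trans (iS _ _ Au0) ((svalP u0).2 x)).
  by exists (exist _ (fun x => inf (S x)) (conj sI pI)) => u Au; apply/asboolP => x; exact: iS.
- exists q; split => // q' sq' q'q.
  have q'p x : q' x <= p x by exact: le_trans (qp x).
  have /= := qmin (exist _ q' (conj sq' q'p)).
  by move=> /(_ _)H; apply: (congr1 sval (H _)); exact/asboolP.
Qed.

(* A minimal sublinear function is additive, by minimality against the functions
   given by cone_sublinear for the rays through (- z, - q z). *)
Theorem hahn_banach p K : sublinear p -> cone K ->
    (forall v s, K (v, s) -> 0 <= p (- v) + s) ->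
  exists phi : {linear X -> R^o}, (forall x, phi x <= p x) /\
    forall v s, K (v, s) -> phi v <= s.
Proof.
move=> sp cK /(cone_sublinear sp cK)[p' [sp' p'p p'K]].
have [q [sq qp' qmin]] := minimal_sublinear sp'.
have qD x z : q (x + z) = q x + q z.
  apply/eqP; rewrite eq_le sq.1/=.
  have [|q' [sq' q'q]] := cone_sublinear sq (cone_ray (- z) (- q z)).
    by move=> _ _ [t /= t0 [<- <-]]; rewrite scalerN opprK sq.2//; lra.
  move=> /(_ (- z) (- q z)); rewrite (qmin q')// => qz.
  have {qz}/qz : [set (t *: - z, t * - q z) | t in [set t | 0 <= t]] (- z, - q z).
    by exists 1; rewrite ?scale1r ?mul1r//= ler01.
  by have := sq.1 (x + z) (- z); rewrite addrK; lra.
have qN x : q (- x) = - q x.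
  by apply/eqP; rewrite -addr_eq0 -qD addNr (sublinear0 sq).
have qlin : linear (q : X -> R^o).
  move=> t x y; rewrite qD; congr (_ + _).
  have [t0|t0] := leP 0 t; first by rewrite sq.2.
  by rewrite -[t]opprK scaleNr qN sq.2 ?oppr_ge0 ?(ltW t0)// scaleNr.
pose h := GRing.isLinear.Build _ _ _ _ _ qlin.
pose phi : {linear X -> R^o} := HB.pack (q : X -> R^o) h.
exists phi; split => [x|v s Kvs]; first exact: le_trans (p'p x).
exact: le_trans (p'K _ _ Kvs).
Qed.

End HahnBanach.

(** The ray through [(- x, - p x)] imposes [p x <= phi x], which together with [phi <= p] is an
    equality. *)
Lemma norming_functional (R : realType) (X : lmodType R) (p : X -> R) (x : X) :
  sublinear p ->
  exists phi : {linear X -> R^o}, (forall z, phi z <= p z) /\ phi x = p x.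
Proof.
move=> sp; have [|phi [phip phiK]] :=
    hahn_banach sp (cone_ray (- x) (- p x)).
  by move=> _ _ [t /= t0 [<- <-]]; rewrite scalerN opprK sp.2//; lra.
exists phi; split=> //; apply/eqP; rewrite eq_le phip/=.
have /phiK : [set (t *: - x, t * - p x) | t in [set t | 0 <= t]] (- x, - p x).
  by exists 1; rewrite ?scale1r ?mul1r//= ler01.
by rewrite linearN lerN2.
Qed.

Lemma dominated_continuous (R : realType) (X : normedModType R)
    (phi : {linear X -> R^o}) (C : R) :
  (forall x, phi x <= C * `|x|) -> continuous phi.
Proof.
move=> phiC; apply: bounded_linear_continuous; apply/linear_boundedP.
exists C; rewrite num_real; split=> // M CM x.
apply: (@le_trans _ _ (C * `|x|)); last by rewrite ler_wpM2r// ltW.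
rewrite ler_norml phiC andbT lerNl -linearN.
by apply: le_trans (phiC _) _; rewrite normrN.
Qed.

(** * Limits along a free ultrafilter *)

Section FreeUltrafilter.

Definition free_ultra : set_system nat :=
  sval (cid (ultraFilterLemma (eventually_filter))).

#[global] Instance free_ultra_ultra : UltraFilter free_ultra.
Proof. by rewrite /free_ultra; case: cid => ? []. Qed.

Lemma free_ultra_oo : \oo `<=` free_ultra.
Proof. by rewrite /free_ultra; case: cid => ? []. Qed.

Variable R : realType.
Implicit Types f g : nat -> R.

Definition ulim f : R := lim (f @ free_ultra).

Lemma ulimE f (l : R) : f n @[n --> free_ultra] --> l -> ulim f = l.
Proof. exact: cvg_lim. Qed.

Lemma cvgn_ultra f (l : R) : f n @[n --> \oo] --> l -> f n @[n --> free_ultra] --> l.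
Proof. by move=> fl A /fl; exact: free_ultra_oo. Qed.

(** A cluster point in the compact segment from [- M] to [M] is a limit, since an ultrafilter
    contains every set or its complement. *)
Lemma bounded_ulim f M : (forall n, `|f n| <= M) -> f n @[n --> free_ultra] --> ulim f.
Proof.
move=> fM; have [|p [_ clp]] := @segment_compact R (- M) M (f @ free_ultra) _.
  by apply: nearW => n /=; rewrite in_itv/= -ler_norml.
suff fp : f @ free_ultra --> p by rewrite (ulimE fp).
move=> A Ap; have [//|nA] := in_ultra_setVsetC (f @^-1` A) free_ultra_ultra.
have [//|x [] nAx Ax] := clp (~` A) A _ Ap.
by [].
Qed.

End FreeUltrafilter.

(** * Iterated limits as compositions of operators *)

Section Shift.
Variables (R : realType) (X : normedModType R).
Implicit Types (F : X -> R) (y : nat -> X).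

(* C-Lipschitz; one inequality suffices by symmetry. *)
Definition clip (C : R) F := forall x x', F x - F x' <= C * `|x - x'|.

Lemma clip_norm C F x x' : clip C F -> `|F x - F x'| <= C * `|x - x'|.
Proof.
by move=> cF; rewrite ler_norml lerNl opprB {1}distrC !cF.
Qed.

Lemma clip_sublinear C F : sublinear F -> (forall x, F x <= C * `|x|) -> clip C F.
Proof.
move=> sF FC x x'; rewrite -{1}(subrK x' x) (le_trans _ (FC (x - x')))//.
by rewrite lerBlDr sF.1.
Qed.

(** A limit along [y] seen as an operator on functions of [x]. It preserves Lipschitz functions, so
    it can be iterated, and the value of a spreading model is a composition of such operators
    applied to the norm and evaluated at 0. *)
Definition ushift y (a : R) F x := ulim (fun n => F (x + a *: y n)).

Definition iter_ushift y (a : seq R) F := foldr (ushift y) F a.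

Variables (y : nat -> X) (M : R).
Hypothesis yM : forall n, `|y n| <= M.

Lemma ushift_cvg C F a x : clip C F ->
  F (x + a *: y n) @[n --> free_ultra] --> ushift y a F x.
Proof.
move=> cF; apply: (@bounded_ulim _ _ (`|F x| + `|C| * (`|a| * M))) => n.
rewrite -(subrK (F x) (F _)) addrC (le_trans (ler_normD _ _))// lerD2l.
apply: le_trans (clip_norm _ _ cF) _; rewrite addrAC subrr add0r normrZ.
apply: (@le_trans _ _ (`|C| * (`|a| * `|y n|))).
  by rewrite ler_wpM2r ?ler_norm// mulr_ge0.
by rewrite ler_wpM2l// ler_wpM2l.
Qed.

Lemma ushift_le C D F G a b x z c : clip C F -> clip D G ->
  (\forall n \near free_ultra, F (x + a *: y n) <= G (z + b *: y n) + c) ->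
  ushift y a F x <= ushift y b G z + c.
Proof.
move=> cF cG FG; apply: ler_cvg_to (ushift_cvg cF) _ FG.
by apply: cvgD; [exact: ushift_cvg cG|exact: cvg_cst].
Qed.

Lemma ushift_clip C F a : clip C F -> clip C (ushift y a F).
Proof.
move=> cF x x'; rewrite lerBlDl; apply: (ushift_le cF cF).
by apply: nearW => n; rewrite -lerBlDl (le_trans (cF _ _))// opprD addrACA subrr addr0.
Qed.

Lemma iter_ushift_clip C F a : clip C F -> clip C (iter_ushift y a F).
Proof. by move=> cF; elim: a => //= a s; exact: ushift_clip. Qed.

(** An ordinary limit is also the limit along the ultrafilter. The hypotheses on a spreading model
    can thus be combined with limits that exist along the ultrafilter only. *)
Lemma iterated_lim_ushift C F a x l : clip C F ->
  iterated_lim F y a x l -> l = iter_ushift y a F x.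
Proof.
move=> cF; elim: a x l => [|a s IH] x l//= [g [/(_ _)/IH gE gl]].
rewrite /ushift -(ulimE (cvgn_ultra gl)); congr (ulim _); apply/funext => n.
exact: gE.
Qed.

End Shift.

(** * Construction of the renorming *)

Section SeriesNorm.
Variables (R : realType) (X : normedModType R) (u : nat -> X -> R).
Hypothesis u_sublinear : forall i, sublinear (u i).
Hypothesis uN : forall i x, u i (- x) = u i x.
Hypothesis u_le : forall i x, u i x <= 2 ^- i.+1 * `|x|.

Lemma sublinear_ge0 (V : lmodType R) (p : V -> R) x :
  sublinear p -> p (- x) = p x -> 0 <= p x.
Proof. by move=> sp pN; have := sublinearN x sp; rewrite pN; lra. Qed.

Let u_ge0 i x : 0 <= u i x. Proof. exact: sublinear_ge0. Qed.

Definition series_norm x : R := limn (series (fun i => u i x)).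

Let partial_le n x : series (fun i => u i x) n <= (1 - 2 ^- n) * `|x|.
Proof.
elim: n => [|n IH]; first by rewrite seriesEnat/= big_geq// expr0 invr1 subrr mul0r.
rewrite seriesSr (le_trans (lerD IH (u_le n x)))// -mulrDl ler_wpM2r//.
rewrite -addrA lerD2l exprS invfM; have : 0 < (2:R) ^- n by rewrite invr_gt0 exprn_gt0.
lra.
Qed.

Let cvg_u x : cvgn (series (fun i => u i x)).
Proof.
apply: nondecreasing_is_cvgn; first exact: nondecreasing_series.
exists `|x| => _ [n _ <-]; apply: le_trans (partial_le n x) _.
by rewrite ler_piMl// gerBl invr_ge0 exprn_ge0.
Qed.

Lemma series_norm_le x : series_norm x <= `|x|.
Proof.
apply: limr_le; first exact: cvg_u.
apply: nearW => n; apply: le_trans (partial_le n x) _.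
by rewrite ler_piMl// gerBl invr_ge0 exprn_ge0.
Qed.

Lemma series_normN x : series_norm (- x) = series_norm x.
Proof. by congr (limn (series _)); apply/funext => i. Qed.

(** What is left is the sum of the other terms. Its sublinearity is what allows an equality for the
    whole norm to be transferred to the single term [u q]. *)
Lemma series_norm_sub q : sublinear (fun x => series_norm x - u q x).
Proof.
have cvgq x : \sum_(i < n | (i != q :> nat)) u i x @[n --> \oo] -->
    series_norm x - u q x.
  apply: (@cvg_trans _ ((series (fun i => u i x) n - u q x) @[n --> \oo])).
    apply: near_eq_cvg; exists q.+1 => // n /= qn.
    by rewrite /series/= big_mkord (bigD1 (Ordinal qn))//= addrAC subrr add0r.
  by apply: cvgB; [exact: cvg_u|exact: cvg_cst].
split=> [x y|t x t0].
  apply: (ler_cvg_to (cvgq (x + y)) (cvgD (cvgq x) (cvgq y))).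
  apply: nearW => n; rewrite -[leRHS]big_split.
  by apply: ler_sum => i _; exact: (u_sublinear i).1.

apply: (cvg_unique _ (cvgq (t *: x))) => //.
rewrite (_ : (fun n => _) = (fun n => t * \sum_(i < n | i != q :> nat) u i x)).
  by apply: cvgMr; exact: cvgq.
by apply/funext => n; rewrite mulr_sumr; apply: eq_bigr => i _; rewrite (u_sublinear i).2.
Qed.

Lemma series_norm_sublinear : sublinear series_norm.
Proof.
have [sD sZ] := series_norm_sub 0; split => [x y|t x t0].
  by have := sD x y; have := (u_sublinear 0).1 x y; lra.
have := sZ t x t0; rewrite (u_sublinear 0).2// mulrBr => /addIr; exact.
Qed.

Lemma le_series_norm q x : u q x <= series_norm x.
Proof.
rewrite -subr_ge0; apply: (sublinear_ge0 (series_norm_sub q)).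
by rewrite uN series_normN.
Qed.

End SeriesNorm.

Section Renorming.
Variables (R : realType) (X : normedModType R).
Implicit Types (d x : X) (s : R).

(* For fixed d this is a seminorm in (s, x), even in s, hence nondecreasing in
   s >= 0; this is why sym_renorm below is still convex in x. *)
Definition sym_norm d s x : R := `|s *: d + x| + `|s *: d - x|.

Lemma sym_norm_ge d s x : 2 * `|x| <= sym_norm d s x.
Proof.
apply: le_trans (ler_normB (s *: d + x) (s *: d - x)).
rewrite opprD opprK addrACA subrr add0r -(mulr2n x).
by rewrite -[x *+ 2]scaler_nat normrZ ger0_norm.
Qed.

Lemma sym_norm_le d s s' x : 0 <= s <= s' -> sym_norm d s x <= sym_norm d s' x.
Proof.
move=> /andP[s0 ss']; have := le_trans s0 ss'; rewrite le_eqVlt => /predU1P[s'0|s'0].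
  by have -> : s = s' by lra.
(* After division by [2 * s'], this writes [s *: d + z] as a convex combination of [s' *: d + z] and
   [- (s' *: d - z)]; the cases [z = x] and [z = - x] are then added. *)
have e z : (2 * s') *: (s *: d + z) =
    (s' + s) *: (s' *: d + z) + (s' - s) *: - (s' *: d - z).
  rewrite opprD opprK !scalerDr !scalerN !scalerA addrACA -scalerBl -scalerDl.
  by congr (_ *: _ + _ *: _); lra.
have e' z : 2 * s' * `|s *: d + z| <=
    (s' + s) * `|s' *: d + z| + (s' - s) * `|s' *: d - z|.
  rewrite -[X in X * _ <= _]ger0_norm; last by lra.
  rewrite -normrZ e; apply: le_trans (ler_normD _ _) _.
  by rewrite !normrZ normrN !ger0_norm; lra.
rewrite -(@ler_pM2l _ (2 * s')) ?mulr_gt0//.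
rewrite /sym_norm mulrDr (le_trans (lerD (e' _) (e' _)))// opprK; lra.
Qed.

Definition sym_renorm d x := sym_norm d `|x| x.

Lemma sym_renorm_sublinear d : sublinear (sym_renorm d).
Proof.
split => [x y|t x t0].
  apply: (@le_trans _ _ (sym_norm d (`|x| + `|y|) (x + y))).
    by apply: sym_norm_le; rewrite normr_ge0 ler_normD.
  rewrite /sym_renorm /sym_norm scalerDl opprD.
  rewrite [X in `|X| + _]addrACA [X in _ + `|X|]addrACA [leRHS]addrACA.
  by apply: lerD; exact: ler_normD.
rewrite /sym_renorm /sym_norm normrZ ger0_norm// -scalerA -scalerDr -scalerBr.
by rewrite 2!normrZ ger0_norm// mulrDr.
Qed.

Lemma sym_renormN d x : sym_renorm d (- x) = sym_renorm d x.
Proof. by rewrite /sym_renorm /sym_norm normrN opprK addrC. Qed.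

Lemma sym_renorm_le d x : sym_renorm d x <= 2 * (1 + `|d|) * `|x|.
Proof.
rewrite /sym_renorm /sym_norm (le_trans (lerD (ler_normD _ _) (ler_normB _ _)))//.
rewrite !normrZ normr_id; lra.
Qed.

Lemma equivalent_norm_sublinear (N : X -> R) : equivalent_norm N -> sublinear N.
Proof. by move=> [ND NZ _ _]; split=> // t x t0; rewrite NZ ger0_norm. Qed.

(** The bound on the remainder [N x - c * sym_renorm (d q) x] makes the functionals that support it
    continuous. The term of index 0 alone makes [N] dominate a multiple of the given norm. *)
Lemma symmetric_renorming (d : nat -> X) : exists2 N, equivalent_norm N &
  forall q, exists c, [/\ 0 < c, sublinear (fun x => N x - c * sym_renorm (d q) x) &
    forall x, N x - c * sym_renorm (d q) x <= `|x|].
Proof.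
(* The denominator absorbs the constant of [sym_renorm_le], so that the term of index [q] is at most
   [2 ^- q.+1] times the norm. *)
pose c q : R := 2 ^- q.+1 / (2 * (1 + `|d q|)).
have d0 q : 0 < 2 * (1 + `|d q|) by rewrite mulr_gt0// ltr_pwDl.
have c0 q : 0 < c q by rewrite divr_gt0// invr_gt0 exprn_gt0.
pose u q x := c q * sym_renorm (d q) x.
have us q : sublinear (u q).
  have [bD bZ] := sym_renorm_sublinear (d q); split=> [x y|t x t0].
    by rewrite /u -mulrDr ler_wpM2l ?bD// ltW.
  by rewrite /u bZ// mulrCA.
have uN q x : u q (- x) = u q x by rewrite /u sym_renormN.
have ule q x : u q x <= 2 ^- q.+1 * `|x|.
  rewrite /u /c -mulrA ler_wpM2l ?invr_ge0 ?exprn_ge0// mulrC ler_pdivrMr//.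
  by rewrite (le_trans (sym_renorm_le _ _))// mulrC.
have sN := series_norm_sublinear us uN ule.
have NN := series_normN uN.
have Nge x : c 0 * 2 * `|x| <= series_norm u x.
  apply: le_trans (le_series_norm us uN ule 0 x).
  by rewrite /u -mulrA ler_wpM2l ?(ltW (c0 _))// sym_norm_ge.
exists (series_norm u); last first.
  move=> q; exists (c q); split=> // [|x]; first exact: series_norm_sub.
  apply: le_trans (series_norm_le us uN ule x); rewrite gerBl.
  by apply: (@sublinear_ge0 _ _ (u q)); [exact: us|exact: uN].
split; first exact: sN.1.
- move=> k x; have [k0|k0] := leP 0 k; first by rewrite sN.2// ger0_norm.
  by rewrite -NN -scaleNr sN.2 ?oppr_ge0 ?(ltW k0)// ltr0_norm.
- move=> x x0; apply/eqP; rewrite -normr_le0.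
  have := Nge x; rewrite x0 pmulr_rle0//.
  by rewrite mulr_gt0.
- exists (c 0 * 2), 1; split=> [||x]; rewrite ?mulr_gt0 ?Nge ?mul1r//=.
  exact: series_norm_le.
Qed.

Lemma dense_sequence : separable X -> exists d : nat -> X,
  forall x e, 0 < e -> exists n, `|x - d n| < e.
Proof.
move=> [D [/pfcard_geP[D0|[g]] dD]].
  by have [|x []] := dD setT _ openT; [exists 0|rewrite D0].
exists g => x e e0.
have [||z [xz Dz]] := dD (ball x e); [|exact: ball_open|].
  by exists x; exact: ballxx.
have [n _ gn] := @surj _ _ _ _ g z Dz.
by exists n; rewrite gn; move: xz; rewrite -ball_normE.
Qed.

End Renorming.

(** * Iterated limits in two indices *)

Section DoubleLimit.
Variable R : realType.
Implicit Types (G H : nat -> nat -> R) (f : nat -> R) (l : R).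

(** An iterated limit as a relation: an inequality valid for all [m] and [n] passes to the limit
    together with its error terms, whether they depend on one index or on both. *)
Definition ucvg2 G l := exists2 g : nat -> R,
  forall m, G m n @[n --> free_ultra] --> g m & g m @[m --> free_ultra] --> l.

Lemma ucvg2_l f l : f n @[n --> free_ultra] --> l -> ucvg2 (fun m _ => f m) l.
Proof. by exists f => // m; exact: cvg_cst. Qed.

Lemma ucvg2_r f l : f n @[n --> free_ultra] --> l -> ucvg2 (fun _ => f) l.
Proof. by exists (fun=> l) => //; exact: cvg_cst. Qed.

Lemma ucvg2_cst l : ucvg2 (fun _ _ => l) l.
Proof. by apply: ucvg2_l; exact: cvg_cst. Qed.

Lemma ucvg2D G H l l' : ucvg2 G l -> ucvg2 H l' ->
  ucvg2 (fun m n => G m n + H m n) (l + l').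
Proof.
move=> [g Gg gl] [h Hh hl']; exists (fun m => g m + h m); last exact: cvgD.
by move=> m; apply: cvgD.
Qed.

Lemma ucvg2M c G l : ucvg2 G l -> ucvg2 (fun m n => c * G m n) (c * l).
Proof.
by move=> [g Gg gl]; exists (fun m => c * g m) => [m|]; apply: cvgMr.
Qed.

Lemma ucvg2B G H l l' : ucvg2 G l -> ucvg2 H l' ->
  ucvg2 (fun m n => G m n - H m n) (l - l').
Proof.
move=> [g Gg gl] [h Hh hl']; exists (fun m => g m - h m); last exact: cvgB.
by move=> m; apply: cvgB.
Qed.

Lemma ucvg2_le G H l l' : ucvg2 G l -> ucvg2 H l' ->
  (forall m n, G m n <= H m n) -> l <= l'.
Proof.
move=> [g Gg gl] [h Hh hl'] GH; apply: (ler_cvg_to gl hl'); apply: nearW => m.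
by apply: (ler_cvg_to (Gg m) (Hh m)); exact: nearW.
Qed.

Variables (X : normedModType R) (y : nat -> X) (M : R).
Hypothesis yM : forall n, `|y n| <= M.

Lemma ucvg2_ushift C (F : X -> R) a b x : clip C F ->
  ucvg2 (fun m n => F (x + a *: y m + b *: y n)) (ushift y a (ushift y b F) x).
Proof.
move=> cF; exists (fun m => ushift y b F (x + a *: y m)) => [m|].
  exact: (ushift_cvg yM cF).
by apply: (ushift_cvg yM); exact: ushift_clip cF.
Qed.

End DoubleLimit.

(** * Limit inequalities drawn from the spreading model *)

Section TailIdentities.
Variables (R : realType) (X : normedModType R) (y : nat -> X) (M : R).
Hypothesis yM : forall n, `|y n| <= M.
Implicit Types (p d : X) (a b s t w : R).

Lemma clip_normr : clip 1 (fun x : X => `|x|).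
Proof. by move=> x x'; rewrite mul1r lerB_dist. Qed.

(** This is $\tau(p, a)$; for [a = 1] it is the type generated by [y] in the sense of Krivine and
    Maurey. *)
Definition tail_norm a p := ushift y a (fun x => `|x|) p.
Definition tail_norm2 a b p := ushift y a (ushift y b (fun x => `|x|)) p.

Lemma tail_norm_cvg a p : `|p + a *: y n| @[n --> free_ultra] --> tail_norm a p.
Proof. by apply: (ushift_cvg yM); exact: clip_normr. Qed.

Arguments tail_norm_cvg : clear implicits.

Lemma tail_norm2_cvg a b p :
  ucvg2 (fun m n => `|p + a *: y m + b *: y n|) (tail_norm2 a b p).
Proof. by apply: (ucvg2_ushift yM); exact: clip_normr. Qed.

Lemma tail_norm_clip a : clip 1 (tail_norm a).
Proof. exact: (ushift_clip yM a clip_normr). Qed.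

Lemma tail_norm2_clip a b : clip 1 (tail_norm2 a b).
Proof. exact: (ushift_clip yM a (tail_norm_clip b)). Qed.

Lemma tail_norm_le a b p : tail_norm a p <= tail_norm b p + M * `|a - b|.
Proof.
apply: ler_cvg_to (tail_norm_cvg a p) (cvgD (tail_norm_cvg b p) (cvg_cst _)) _.
apply: nearW => n; rewrite [leRHS]/=.
apply: (@le_trans _ _ (`|p + b *: y n| + `|(a - b) *: y n|)).
  by rewrite (le_trans _ (ler_normD _ _))// scalerBl addrACA subrr addr0.
by rewrite lerD2l normrZ mulrC ler_wpM2r.
Qed.

Lemma tail_normZ c a p : 0 <= c -> tail_norm (c * a) (c *: p) = c * tail_norm a p.
Proof.
move=> c0; apply: cvg_unique (tail_norm_cvg _ _) _ => //.
rewrite (_ : (fun n => _) = (fun n => c * `|p + a *: y n|)); last first.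
  by apply/funext => n; rewrite -scalerA -scalerDr normrZ ger0_norm.
by apply: cvgMr; exact: tail_norm_cvg.
Qed.

Lemma tail_norm2Z c a b p : 0 <= c ->
  c * tail_norm2 a b p <= tail_norm2 (c * a) (c * b) (c *: p).
Proof.
move=> c0; apply: ucvg2_le (ucvg2M c (tail_norm2_cvg a b p)) (tail_norm2_cvg _ _ _) _.
by move=> m n; rewrite -!scalerA -!scalerDr normrZ ger0_norm.
Qed.

Lemma tail_norm2_lerD e f p : tail_norm2 e f (2 *: p) <= tail_norm e p + tail_norm f p.
Proof.
apply: ucvg2_le (tail_norm2_cvg _ _ _) (ucvg2D (ucvg2_l (tail_norm_cvg e p))
  (ucvg2_r (tail_norm_cvg f p))) _ => m n.
by rewrite (le_trans _ (ler_normD _ _))// scaler_nat mulr2n addrACA addrA.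
Qed.

Lemma sym_norm_lipschitz d s s' (x : X) : sym_norm d s x <= sym_norm d s' x + 2 * `|d| * `|s - s'|.
Proof.
have h z : `|s *: d + z| <= `|s' *: d + z| + `|d| * `|s - s'|.
  rewrite mulrC -normrZ (le_trans _ (ler_normD _ _))//.
  by rewrite scalerBl addrAC addrCA subrr addr0.
by rewrite /sym_norm (le_trans (lerD (h _) (h _)))//; lra.
Qed.

Variables (N : X -> R) (d : X) (c : R).
Hypothesis N_norm : equivalent_norm N.
Hypothesis yN : forall n, N (y n) = 1.
Hypothesis c_gt0 : 0 < c.
Hypothesis Nc : sublinear (fun x => N x - c * sym_renorm d x).
Hypothesis Nc_le : forall x, N x - c * sym_renorm d x <= `|x|.

Local Notation lam := (ulim (fun n => `|y n|)).

Let lam_cvg : `|y n| @[n --> free_ultra] --> (lam : R).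
Proof. by apply: (@bounded_ulim _ _ M) => n; rewrite normr_id. Qed.

Let N_clip : exists C, clip C N.
Proof.
have [_ _ _ [A [B [_ _ AB]]]] := N_norm.
exists B; apply: clip_sublinear; first exact: equivalent_norm_sublinear.
by move=> x; have /andP[] := AB x.
Qed.

Let delta_cvg : `| `|y n| - lam| @[n --> free_ultra] --> (0 : R).
Proof.
rewrite -[X in _ --> X](normr0 R) -[X in `|X|](subrr (lam : R)).
by apply: cvg_norm; apply: cvgB => //; exact: cvg_cst.
Qed.

(** In the limit [N (y m + w *: y n)] reaches [N (y m) + N (w *: y n)]; as the remainder is
    subadditive, [sym_renorm d] loses nothing on this sum either. The norm of [y m + w *: y n] is at
    most [|y m| + |y n|], so monotonicity in [s] lets [2 * lam] take its place. The result is a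
    lower bound for a sum over the sign patterns [(1, w)] and [(- 1, - w)]. *)
Lemma l1_tail_norm2_dense w : w = 1 \/ w = -1 ->
  ushift y 1 (ushift y w N) 0 = 2 ->
  tail_norm 1 (lam *: d) + tail_norm w (lam *: d) <=
    tail_norm2 1 w (2 *: (lam *: d)).
Proof.
move=> w1 N2; set q := lam *: d.
have [C cN] := N_clip.
have wn : `|w| = 1 by case: w1 => ->; rewrite ?normrN normr1.
have bw x : sym_renorm d (w *: x) = sym_renorm d x.
  by case: w1 => ->; rewrite ?scaleN1r ?sym_renormN ?scale1r.
have Nw x : N (w *: x) = N x by have [_ -> _ _] := N_norm; rewrite wn mul1r.
have T a p := tail_norm_cvg a p.
(* The left side is the limit of [N (y m + w *: y n) - 2]; the zeros on the right are the limits of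
   the errors made in replacing [|y m|] and [|y n|] by [lam]. *)
have key : 2 - 2 <= c * (tail_norm2 1 w (2 *: q) + tail_norm2 (-1) (- w) (2 *: q)
    - (tail_norm 1 q + tail_norm (-1) q) - (tail_norm 1 q + tail_norm (-1) q)
    + 4 * `|d| * 0 + 4 * `|d| * 0).
  rewrite -{1}N2.
  have lhs := ucvg2B (ucvg2_ushift yM 1 w 0 cN) (ucvg2_cst 2).
  have D2 := ucvg2D (tail_norm2_cvg 1 w (2 *: q)) (tail_norm2_cvg (-1) (- w) (2 *: q)).
  have D1 := ucvg2B D2 (ucvg2D (ucvg2_l (T 1 q)) (ucvg2_l (T (-1) q))).
  have D0 := ucvg2B D1 (ucvg2D (ucvg2_r (T 1 q)) (ucvg2_r (T (-1) q))).
  have E1 := ucvg2D D0 (ucvg2M (4 * `|d|) (ucvg2_l delta_cvg)).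
  have E0 := ucvg2D E1 (ucvg2M (4 * `|d|) (ucvg2_r delta_cvg)).
  apply: ucvg2_le lhs (ucvg2M c E0) _ => m n.
  rewrite add0r scale1r.
  set dm := `| `|y m| - lam|; set dn := `| `|y n| - lam|.
  have h1 : N (y m + w *: y n) - 2 <=
      c * (sym_renorm d (y m + w *: y n) - sym_renorm d (y m) - sym_renorm d (y n)).
    have := Nc.1 (y m) (w *: y n); rewrite Nw bw !yN; lra.
  apply: le_trans h1 _; rewrite ler_pM2l//.
  have h2 : sym_renorm d (y m + w *: y n) <=
      sym_norm d (2 * lam) (y m + w *: y n) + 2 * `|d| * (dm + dn).
    apply: (@le_trans _ _ (sym_norm d (`|y m| + `|y n|) (y m + w *: y n))).
      apply: sym_norm_le; rewrite normr_ge0/= (le_trans (ler_normD _ _))//.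
      by rewrite normrZ wn mul1r.
    apply: le_trans (sym_norm_lipschitz _ _ (2 * lam) _) _.
    rewrite lerD2l ler_wpM2l ?mulr_ge0// mulr2n mulrDl mul1r opprD addrACA.
    exact: ler_normD.
  have h3 k : sym_norm d lam (y k) <= sym_renorm d (y k) + 2 * `|d| * `| `|y k| - lam|.
    by rewrite distrC; exact: sym_norm_lipschitz.
  have := h3 m; have := h3 n; move: h2; rewrite -/dm -/dn.
  rewrite /sym_norm opprD !scaleN1r scaleNr !addrA -scalerA -/q !scale1r.
  by lra.
(* The triangle inequality bounds the contribution of [(- 1, - w)] from above, so that the whole
   deficit is excluded for [(1, w)]. *)
have := tail_norm2_lerD 1 w q; have := tail_norm2_lerD (-1) (- w) q.
move: key; rewrite subrr pmulr_rge0// => key.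
have : tail_norm w q + tail_norm (- w) q = tail_norm 1 q + tail_norm (- 1) q.
  by case: w1 => ->; rewrite ?opprK// addrC.
by lra.
Qed.

Hypothesis y_null : weakly_cvg y 0.

(** A functional supporting [P] at [x] is continuous by the bound on [P], hence null along [y]. This
    is weak lower semicontinuity of [P] with the explicit error [phi (y n)]. *)
Lemma norming_weakly_null (P : X -> R) (C : R) (x : X) : sublinear P ->
  (forall x, P x <= C * `|x|) -> exists phi : {linear X -> R^o},
  (forall z, P x + phi z <= P (x + z)) /\
  phi (y n) @[n --> free_ultra] --> (0 : R).
Proof.
move=> sP PC; have [phi [phiP phix]] := norming_functional x sP.
exists phi; split.
- by move=> z; rewrite -phix -linearD.
- apply: cvgn_ultra; rewrite -(linear0 phi); apply: y_null.
  by apply: (@dominated_continuous _ _ _ C) => z; apply: le_trans (phiP z) _.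
Qed.

Lemma norm_norming x : exists phi : {linear X -> R^o},
  (forall z, `|x| + phi z <= `|x + z|) /\
  phi (y n) @[n --> free_ultra] --> (0 : R).
Proof.
apply: (@norming_weakly_null (fun x => `|x|) 1); last by move=> z; rewrite mul1r.
by split=> [u v|t u t0]; [exact: ler_normD|rewrite normrZ ger0_norm].
Qed.

Lemma le_tail_norm a p : `|p| <= tail_norm a p.
Proof.
have [psi [psile psi0]] := norm_norming p.
have : a * psi (y n) @[n --> free_ultra] --> a * (0 : R) by apply: cvgMr.
rewrite mulr0 => /(cvgD (cvg_cst `|p|)); rewrite addr0 => psia.
apply: ler_cvg_to psia (tail_norm_cvg a p) _.
by apply: nearW => n; apply: le_trans (psile _); rewrite linearZ.
Qed.

(** Weak lower semicontinuity at each [p + e *: y m]: the functional depends on [m] only and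
    vanishes in the inner limit. *)
Lemma tail_norm_le2 e p : tail_norm e p <= tail_norm2 e e p.
Proof.
have /choice[psi hpsi] m := norm_norming (p + e *: y m).
have psi0 : ucvg2 (fun m n => psi m (y n)) 0.
  by exists (fun=> 0) => [m|]; [exact: (hpsi m).2|exact: cvg_cst].
have := ucvg2D (ucvg2_l (tail_norm_cvg e p)) (ucvg2M e psi0).
rewrite mulr0 addr0 => h.
apply: ucvg2_le h (tail_norm2_cvg _ _ _) _ => m n.
by apply: le_trans ((hpsi m).1 _); rewrite linearZ.
Qed.

(** In the limit [y m] and [y m + y n] have the same [N]-norm, while weak lower semicontinuity keeps
    the remainder from decreasing; hence [sym_renorm d] does not increase from one to the other. The
    norm of [y m + y n] is asymptotically at least [lam], so by monotonicity [lam] can take its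
    place. This bounds a sum over two signs, and [tail_norm_le2] for the sign -1 isolates the
    other. *)
Lemma c0_tail_norm2_dense : ushift y 1 (ushift y 1 N) 0 = 1 ->
  tail_norm2 1 1 (lam *: d) <= tail_norm 1 (lam *: d).
Proof.
move=> N1; set q := lam *: d.
have lam0 : 0 <= lam by apply: (cvgr_to_ge lam_cvg); exact: nearW.
have [C cN] := N_clip.
have T a p := tail_norm_cvg a p.
have Nc1 x : N x - c * sym_renorm d x <= 1 * `|x| by rewrite mul1r.
have /choice[phi hphi] m := norming_weakly_null (y m) Nc Nc1.
have /choice[psi hpsi] m := norm_norming (y m).
have phi0 : ucvg2 (fun m n => phi m (y n)) 0.
  by exists (fun=> 0) => [m|]; [exact: (hphi m).2|exact: cvg_cst].
have psi0 : ucvg2 (fun m n => `|psi m (y n)|) 0.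
  exists (fun=> 0) => [m|]; last exact: cvg_cst.
  by rewrite -[X in _ --> X](normr0 R); apply: cvg_norm; exact: (hpsi m).2.
have key : c * (tail_norm2 1 1 q + tail_norm2 (-1) (-1) q
    - (tail_norm 1 q + tail_norm (-1) q)
    - 2 * `|d| * (2 * 0 + 0)) + 0 <= 1 - 1.
  rewrite -[X in _ <= X - _]N1.
  have rhs := ucvg2B (ucvg2_ushift yM 1 1 0 cN) (ucvg2_cst 1).
  have D2 := ucvg2D (tail_norm2_cvg 1 1 q) (tail_norm2_cvg (-1) (-1) q).
  have D1 := ucvg2B D2 (ucvg2D (ucvg2_l (T 1 q)) (ucvg2_l (T (-1) q))).
  have E0 := ucvg2D (ucvg2M 2 (ucvg2_l delta_cvg)) psi0.
  have E1 := ucvg2D (ucvg2M c (ucvg2B D1 (ucvg2M (2 * `|d|) E0))) phi0.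
  apply: ucvg2_le E1 rhs _ => m n.
  rewrite add0r !scale1r !scaleN1r; set dm := `| `|y m| - lam|.
  have h1 := (hphi m).1 (y n).
  have h2 : sym_norm d lam (y m + y n) <=
      sym_renorm d (y m + y n) + 2 * `|d| * (dm + `|psi m (y n)|).
    (* If the norm of [y m + y n] is below [lam], it is still at least [|y m| + psi m (y n)], so
       that replacing it by [lam] costs an error that vanishes. *)
    have [le|lt] := leP lam `|y m + y n|.
      apply: (@le_trans _ _ (sym_renorm d (y m + y n))).
        by apply: sym_norm_le; rewrite lam0.
      by rewrite lerDl mulr_ge0 ?mulr_ge0// addr_ge0 ?normr_ge0.
    apply: le_trans (sym_norm_lipschitz _ _ `|y m + y n| _) _.
    rewrite lerD2l ler_wpM2l ?mulr_ge0// gtr0_norm ?subr_gt0//.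
    have := (hpsi m).1 (y n); have := ler_norm (lam - `|y m|).
    rewrite distrC -/dm; have := ler_norm (- psi m (y n)); rewrite normrN.
    by lra.
  have h3 : sym_renorm d (y m) <= sym_norm d lam (y m) + 2 * `|d| * dm.
    exact: sym_norm_lipschitz.
  have h4 : c * (sym_norm d lam (y m + y n) - sym_norm d lam (y m)
      - 2 * `|d| * (2 * dm + `|psi m (y n)|)) <=
      c * (sym_renorm d (y m + y n) - sym_renorm d (y m)).
    by rewrite ler_pM2l//; lra.
  move: h1 h4; rewrite yN /sym_norm opprD !addrA -/q.
  by lra.
have := tail_norm_le2 1 q; have := tail_norm_le2 (-1) q.
move: key; rewrite subrr mulr0 !addr0 mulr0 subr0 pmulr_rle0//; lra.
Qed.

End TailIdentities.

Arguments tail_norm_cvg {R X y M} yM a p.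

(** For [lam > 0] the points [lam *: d n] are dense. They are the points about which the renorming
    gives information, since the norms of the [y n] tend to [lam]. *)
Lemma le_clip_dense (R : realType) (X : normedModType R) (A B : X -> R) (C D : R)
    (d : nat -> X) (lam : R) : 0 < lam -> clip C A -> clip D B ->
  (forall x e, 0 < e -> exists n, `|x - d n| < e) ->
  (forall n, A (lam *: d n) <= B (lam *: d n)) -> forall p, A p <= B p.
Proof.
move=> lam0 cA cB dd AB p; apply/ler_addgt0Pr => e e0.
pose K := (`|C| + `|D|) * lam + 1.
have K0 : 0 < K by rewrite ltr_wpDl// mulr_ge0 ?(ltW lam0)// addr_ge0.
have [n dn] := dd (lam^-1 *: p) (e / K) (divr_gt0 e0 K0).
have pq : `|p - lam *: d n| = lam * `|lam^-1 *: p - d n|.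
  by rewrite -{1}(scalerKV (lt0r_neq0 lam0) p) -scalerBr normrZ gtr0_norm.
have clipE E F : clip E F -> F p - F (lam *: d n) <= `|E| * `|p - lam *: d n| /\
    F (lam *: d n) - F p <= `|E| * `|p - lam *: d n|.
  move=> cF; split.
    by apply: le_trans (cF _ _) _; rewrite ler_wpM2r ?ler_norm.
  by apply: le_trans (cF _ _) _; rewrite distrC ler_wpM2r ?ler_norm.
have [h1 _] := clipE _ _ cA; have [_ h2] := clipE _ _ cB; have h3 := AB n.
have h4 : (`|C| + `|D|) * `|p - lam *: d n| <= e.
  rewrite pq mulrA; apply: (@le_trans _ _ (K * (e / K))); last first.
    by rewrite mulrC divfK ?gt_eqF.
  by rewrite ler_pM ?mulr_ge0 ?addr_ge0 ?(ltW lam0) ?(ltW dn)// lerDl.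
by move: h4; rewrite mulrDl; lra.
Qed.

Section TailNorm.
Variables (R : realType) (X : normedModType R) (y : nat -> X) (M : R).
Hypothesis yM : forall n, `|y n| <= M.
Implicit Types (p : X) (a b s t w : R).
Local Notation T := (tail_norm y).
Local Notation D := (tail_norm2 y).

Lemma tail_normN a p : T a (- p) = T (- a) p.
Proof.
congr ulim; apply/funext => n.
by rewrite -normrN opprD opprK scaleNr.
Qed.

Lemma tail_norm2N a b p : D a b (- p) = D (- a) (- b) p.
Proof.
have e q : ushift y b (fun x => `|x|) (- q) = ushift y (- b) (fun x => `|x|) q.
  exact: tail_normN.
rewrite /tail_norm2 /ushift; congr ulim; apply/funext => n.
rewrite (_ : - p + a *: y n = - (p + - a *: y n)); first exact: e.
by rewrite opprD scaleNr opprK.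
Qed.

(* On the segment from (e (a + b), 0) to (0, f (a + b)) the convex function
   (s, t) |-> D s t p is, by the midpoint hypothesis, above its chord. *)
Lemma tail_norm2_convex e f a b p : e = 1 \/ e = -1 -> f = 1 \/ f = -1 ->
  0 <= a -> 0 <= b ->
  (forall S, 0 < S ->
    T (e * S) p + T (f * S) p <= 2 * D (e * (S / 2)) (f * (S / 2)) p) ->
  Num.min (T (a + b) p) (T (- (a + b)) p) <= D (e * a) (f * b) p.
Proof.
move=> e1 f1 a0 b0 mid; set S := a + b.
have : 0 <= S by rewrite addr_ge0.
rewrite le_eqVlt => /predU1P[S0|S0].
  have [-> ->] : a = 0 /\ b = 0 by move: S0; rewrite /S; split; lra.
  rewrite -S0 oppr0 minxx !mulr0.
  apply: ucvg2_le (ucvg2_l (tail_norm_cvg yM 0 p)) (tail_norm2_cvg yM _ _ _) _.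
  by move=> m n; rewrite !scale0r !addr0.
have Te : Num.min (T S p) (T (- S) p) <= T (e * S) p.
  by rewrite ge_min; case: e1 => ->; rewrite ?mulN1r ?mul1r lexx ?orbT.
have Tf : Num.min (T S p) (T (- S) p) <= T (f * S) p.
  by rewrite ge_min; case: f1 => ->; rewrite ?mulN1r ?mul1r lexx ?orbT.
set mu := Num.min _ _ in Te Tf *.
have := mid S S0.
have [ab|ba] := leP a b.
  (* As [a <= b], the midpoint of the segment lies between the point of coefficients
     [(e * a, f * b)] and the endpoint [(e * S, 0)]. *)
  have h : (2 * b) * D (e * (S / 2)) (f * (S / 2)) p <=
      S * D (e * a) (f * b) p + (b - a) * T (e * S) p.
    apply: ucvg2_le (ucvg2M _ (tail_norm2_cvg yM _ _ _)) (ucvg2D (ucvg2M _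
      (tail_norm2_cvg yM _ _ _)) (ucvg2M _ (ucvg2_l (tail_norm_cvg yM _ _)))) _.
    move=> m n; rewrite -[X in X * _ <= _]ger0_norm; last lra.
    rewrite -[X in _ <= X * _ + _]ger0_norm; last lra.
    rewrite -[X in _ <= _ + X * _]ger0_norm; last lra.
    rewrite -!normrZ (le_trans _ (ler_normD _ _))//.
    rewrite !scalerDr !scalerA [X in _ <= `|X|]addrAC [X in _ <= `|X + _|]addrACA.
    rewrite -!scalerDl le_eqVlt; apply/orP; left; apply/eqP.
    by congr (`| _ *: _ + _ *: _ + _ *: _|); rewrite /S; field.
  move=> hm; rewrite -(ler_pM2l S0); have h1 := ler_wpM2l b0 hm.
  by have := ler_wpM2l a0 Te; have := ler_wpM2l b0 Tf; move: h h1; rewrite /S; lra.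
have h : (2 * a) * D (e * (S / 2)) (f * (S / 2)) p <=
    S * D (e * a) (f * b) p + (a - b) * T (f * S) p.
  apply: ucvg2_le (ucvg2M _ (tail_norm2_cvg yM _ _ _)) (ucvg2D (ucvg2M _
    (tail_norm2_cvg yM _ _ _)) (ucvg2M _ (ucvg2_r (tail_norm_cvg yM _ _)))) _.
  move=> m n; rewrite -[X in X * _ <= _]ger0_norm; last lra.
  rewrite -[X in _ <= X * _ + _]ger0_norm; last lra.
  rewrite -[X in _ <= _ + X * _]ger0_norm; last lra.
  rewrite -!normrZ (le_trans _ (ler_normD _ _))//.
  rewrite !scalerDr !scalerA [X in _ <= `|X|]addrACA [X in _ <= `|X + _|]addrAC.
  rewrite -!scalerDl le_eqVlt; apply/orP; left; apply/eqP.
  by congr (`| _ *: _ + _ *: _ + _ *: _|); rewrite /S; field.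
move=> hm; rewrite -(ler_pM2l S0); have h1 := ler_wpM2l a0 hm.
by have := ler_wpM2l a0 Te; have := ler_wpM2l b0 Tf; move: h h1; rewrite /S; lra.
Qed.

End TailNorm.

Section TailInequalities.
Variables (R : realType) (X : normedModType R) (y : nat -> X) (M : R).
Variables (N : X -> R) (d : nat -> X).
Hypothesis yM : forall n, `|y n| <= M.
Hypothesis N_norm : equivalent_norm N.
Hypothesis N_sym : forall q, exists c,
  [/\ 0 < c, sublinear (fun x => N x - c * sym_renorm (d q) x) &
    forall x, N x - c * sym_renorm (d q) x <= `|x|].
Hypothesis d_dense : forall x e, 0 < e -> exists n, `|x - d n| < e.
Hypothesis yN : forall n, N (y n) = 1.
Local Notation T := (tail_norm y).
Local Notation D := (tail_norm2 y).

Lemma tail_norm_gt0 : 0 < T 1 0.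
Proof.
have [_ _ _ [A [B [_ B0 AB]]]] := N_norm.
apply: (@lt_le_trans _ _ B^-1); first by rewrite invr_gt0.
apply: (cvgr_to_ge (tail_norm_cvg yM 1 0)); apply: nearW => n.
rewrite add0r scale1r -(ler_pM2l B0) divff ?gt_eqF// -(yN n).
by have /andP[] := AB (y n).
Qed.

Let ulim_gt0 : 0 < ulim (fun n => `|y n|).
Proof.
rewrite (_ : (fun n => _) = (fun n => `|0 + 1 *: y n|)); first exact: tail_norm_gt0.
by apply/funext => n; rewrite add0r scale1r.
Qed.

(** The inequality for the coefficients 1 and [w] extends to every [p] by density, to every scale by
    homogeneity, and to unequal moduli by convexity. *)
Lemma l1_tail_norm2_ge : ushift y 1 (ushift y 1 N) 0 = 2 ->
  ushift y 1 (ushift y (- 1) N) 0 = 2 -> forall s t p,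
  Num.min (T (`|s| + `|t|) p) (T (- (`|s| + `|t|)) p) <= D s t p.
Proof.
move=> N1 N2.
have base w p : w = 1 \/ w = -1 -> T 1 p + T w p <= D 1 w (2 *: p).
  move=> w1; move: p; apply: (@le_clip_dense _ _ _ _ 2 2 d (ulim (fun n => `|y n|))) => //.
  - move=> x x'; have := tail_norm_clip yM 1 x x'; have := tail_norm_clip yM w x x'.
    by lra.
  - move=> x x'; apply: le_trans (tail_norm2_clip yM _ _ _ _) _.
    by rewrite -scalerBr normrZ mul1r ger0_norm.
  - move=> n; have [c [c0 Nc _]] := N_sym n.
    by apply: (l1_tail_norm2_dense yM N_norm yN c0 Nc w1); case: w1 => ->.
have sgnE s : exists2 e : R, e = 1 \/ e = -1 & s = e * `|s|.
  have [s0|s0] := leP 0 s; first by exists 1; [left|rewrite mul1r ger0_norm].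
  by exists (-1); [right|rewrite mulN1r ltr0_norm ?opprK].
move=> s t p; have [e e1 se] := sgnE s; have [f f1 tf] := sgnE t.
rewrite {3}se {3}tf; apply: (tail_norm2_convex yM e1 f1) => // S S0.
have TS u : T (u * S) p = S * T u (S^-1 *: p).
  by rewrite mulrC -(tail_normZ yM)// ?(ltW S0)// scalerKV ?gt_eqF.
have DS : S * D e f (2 *: (S^-1 *: p)) <= 2 * D (e * (S / 2)) (f * (S / 2)) p.
  have := tail_norm2Z yM e f (2 *: (S^-1 *: p)) (ltW (divr_gt0 S0 (ltr0n R 2))).
  rewrite !scalerA mulrA divfK ?pnatr_eq0// divff ?gt_eqF// scale1r !(mulrC (S / 2)).
  by lra.
rewrite !TS -mulrDr; apply: le_trans DS; rewrite ler_pM2l//.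
case: e1 => ->; first exact: base.
(* Passing from [p] to [- p] changes both signs, which reduces [e = -1] to [e = 1]. *)
have := base (- f) (- (S^-1 *: p)); rewrite scalerN tail_norm2N !tail_normN opprK.
apply; case: f1 => ->; rewrite ?opprK; tauto.
Qed.

(** Convexity in [a]: the limit inequality is the case [a = 1], and at [a = 0] both sides agree. *)
Lemma c0_tail_norm2_le : ushift y 1 (ushift y 1 N) 0 = 1 -> weakly_cvg y 0 ->
  forall a p, 0 <= a <= 1 -> D a 1 p <= T 1 p.
Proof.
move=> N1 y0 a p /andP[a0 a1].
have base : D 1 1 p <= T 1 p.
  move: p; apply: (@le_clip_dense _ _ _ _ 1 1 d (ulim (fun n => `|y n|))) => //.
  - exact: tail_norm2_clip.
  - exact: tail_norm_clip.
  - move=> n; have [c [c0 Nc Nc1]] := N_sym n.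
    exact: (c0_tail_norm2_dense yM N_norm yN c0 Nc Nc1).
apply: (@le_trans _ _ ((1 - a) * T 1 p + a * D 1 1 p)); last first.
  by have := ler_wpM2l a0 base; lra.
apply: ucvg2_le (tail_norm2_cvg yM _ _ _) (ucvg2D (ucvg2M _
    (ucvg2_r (tail_norm_cvg yM _ _))) (ucvg2M _ (tail_norm2_cvg yM _ _ _))) _.
move=> m n; rewrite -[X in _ <= X * _ + _]ger0_norm; last lra.
rewrite -[X in _ <= _ + X * _]ger0_norm//.
rewrite -!normrZ (le_trans _ (ler_normD _ _))//.
rewrite !scale1r [X in _ <= `|_ + _ *: X|]addrAC [X in _ <= `|_ + X|]scalerDr.
by rewrite addrA -scalerDl subrK scale1r addrAC.
Qed.

End TailInequalities.

(** * Greedy choice of a basic sequence *)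

(** The [f m] share one Lipschitz constant, so the bound at a point with half the error gives the
    bound on a neighbourhood that does not depend on [m]; compactness makes it uniform on [K]. *)
Lemma compact_near_ultra (R : realType) (V : normedModType R) (K : set V)
    (f : nat -> V -> R) (C : R) :
  compact K -> (forall m x x', f m x - f m x' <= C * `|x - x'|) ->
  (forall x e, K x -> 0 < e -> \forall m \near free_ultra, - e <= f m x) ->
  forall e, 0 < e -> \forall m \near free_ultra, forall x, K x -> - e <= f m x.
Proof.
move=> /compact_near_coveringP cK fC fK e e0.
apply: (cK _ free_ultra (fun m x => - e <= f m x)) => x Kx.
have e20 : 0 < e / 2 by rewrite divr_gt0.
have C1 : 0 < `|C| + 1 by rewrite ltr_wpDl.
near=> x' m.
have h1 : - (e / 2) <= f m x by near: m; exact: fK.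
have h2 : `|x - x'| < e / 2 / (`|C| + 1).
  by near: x'; apply: cvgr_dist_lt; rewrite ?divr_gt0//; exact: cvg_id.
have h3 := fC m x x'; have h4 := ler_norm C.
have : C * `|x - x'| <= e / 2.
  apply: (@le_trans _ _ ((`|C| + 1) * `|x - x'|)).
    by rewrite ler_wpM2r//; lra.
  by rewrite mulrC -ler_pdivlMr// ltW.
by lra.
Unshelve. all: by end_near. Qed.

Section Greedy.
Variables (R : realType) (X : normedModType R) (y : nat -> X).

Lemma compact_translates (K : set X) (x : X) : compact K ->
  compact [set u.1 + u.2 *: x | u in K `*` `[-1, 1 : R]].
Proof.
move=> cK; apply: continuous_compact; last first.
  by apply: compact_setX => //; exact: segment_compact.
apply: continuous_subspaceT => u; apply: cvgD; first exact: cvg_fst.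
by apply: cvgZr_tmp; exact: cvg_snd.
Qed.

(** The combinations of the vectors chosen so far with coefficients of modulus at most 1 form a
    compact set. The next index is chosen for all of them at once, so that [m] does not depend on
    [a]. *)
Lemma greedy_choice (Q : R -> X -> R -> nat -> Prop) :
  (forall K e, compact K -> 0 < e -> \forall m \near free_ultra,
    forall p a, K p -> `|a| <= 1 -> Q e p a m) ->
  forall eps : nat -> R, (forall j, 0 < eps j) -> exists m : nat -> nat,
  forall a : nat -> R, (forall i, `|a i| <= 1) -> forall j,
  Q (eps j) (\sum_(i < j) a i *: y (m i)) (a j) (m j).
Proof.
move=> QK eps eps0; pose S := {K : set X | compact K}.
have /choice[g gP] (u : S * nat) : exists m, forall p a, sval u.1 p ->
    `|a| <= 1 -> Q (eps u.2) p a m.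
  exact: filter_ex (QK _ _ (svalP u.1) (eps0 u.2)).
pose next (j : nat) (K : S) : S :=
  exist _ _ (@compact_translates _ (y (g (K, j))) (svalP K)).
pose K j : S := iteri j next (exist _ _ (@compact_set1 X (0 : X))).
exists (fun j => g (K j, j)) => a a1 j.
apply: (gP (K j, j)) => //=.
elim: j => [|j IH]; first by rewrite big_ord0.
rewrite big_ord_recr/=; exists (\sum_(i < j) a i *: y (g (K i, i : nat)), a j) => //.
by split => //=; rewrite in_itv/= -ler_norml.
Qed.

End Greedy.

Section BasicSequences.
Variables (R : realType) (X : normedModType R) (y : nat -> X) (M : R).
Hypothesis yM : forall n, `|y n| <= M.
Local Notation T := (tail_norm y).
Local Notation D := (tail_norm2 y).

Lemma geometric_eps (l : R) k : 0 < l -> \sum_(i < k) l * 2 ^- i.+1 <= l.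
Proof.
move=> l0; rewrite -mulr_sumr ger_pMr//.
suff -> : \sum_(i < k) 2 ^- i.+1 = 1 - 2 ^- k :> R.
  by rewrite gerBl invr_ge0 exprn_ge0.
elim: k => [|k IH]; first by rewrite big_ord0 expr0 invr1 subrr.
by rewrite big_ord_recr/= IH exprS invfM; lra.
Qed.

(* With mu s p := min (T s p) (T (- s) p), the hypothesis says that, in the limit
   along y m, mu t (p + a y m) is at least mu (|a| + t) p.  Applied once for each
   term of a combination, it moves the coefficients into mu (\sum_i |a i|) 0. *)
Lemma l1_basic_sequence : 0 < T 1 0 -> (forall s t p,
    Num.min (T (`|s| + `|t|) p) (T (- (`|s| + `|t|)) p) <= D s t p) ->
  exists (m : nat -> nat) (A : R), 0 < A /\ forall k (a : nat -> R),
    A * \sum_(i < k) `|a i| <= `|\sum_(i < k) a i *: y (m i)|.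
Proof.
move=> lam0 TD; set lam := T 1 0 in lam0.
pose mu s p := Num.min (T s p) (T (- s) p).
have M0 : 0 <= M by exact: le_trans (yM 0).
have mu_lip s s' p p' : mu s p - mu s' p' <= `|p - p'| + M * `|s - s'|.
  have h u : u = 1 \/ u = -1 -> mu s p <= T (u * s') p' + (`|p - p'| + M * `|s - s'|).
    move=> u1; apply: (@le_trans _ _ (T (u * s) p)).
      by rewrite ge_min; case: u1 => ->; rewrite ?mulN1r ?mul1r lexx ?orbT.
    have := tail_norm_le yM (u * s) (u * s') p; have := tail_norm_clip yM (u * s') p p'.
    rewrite -mulrBr normrM (_ : `|u| = 1) ?mul1r; first lra.
    by case: u1 => ->; rewrite ?normrN normr1.
  rewrite lerBlDl addrC [mu s' p']/mu; case: (leP (T s' p') (T (- s') p')) => _.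
    by have := h 1 (or_introl erefl); rewrite mul1r addrC.
  by have := h (-1) (or_intror erefl); rewrite mulN1r addrC.
pose Q e p a m := forall t, 0 <= t <= 1 ->
  mu (`|a| + t) p - e <= mu t (p + a *: y m).
have QK K e : compact K -> 0 < e -> \forall m \near free_ultra,
    forall p a, K p -> `|a| <= 1 -> Q e p a m.
  move=> cK e0.
  (* Triples [(p, a, t)]: uniformity is needed in the coefficient and in the remaining mass as well
     as in the partial sum. *)
  pose V : normedModType R := (X * R^o * R^o)%type.
  pose f m (v : V) : R := mu v.2 (v.1.1 + v.1.2 *: y m) - mu (`|v.1.2| + v.2) v.1.1.
  pose L : set V := K `*` `[-1, 1] `*` `[0, 1].
  have cL : compact L.
    apply: compact_setX; last exact: segment_compact.
    by apply: compact_setX => //; exact: segment_compact.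
  have fC m x x' : f m x - f m x' <= (2 + 4 * M) * `|x - x'|.
    rewrite /f; set p := x.1.1; set p' := x'.1.1; set b := x.1.2; set b' := x'.1.2.
    have xp : `|p - p'| <= `|x - x'| by rewrite !prod_normE !le_max lexx.
    have xb : `|b - b'| <= `|x - x'| by rewrite !prod_normE !le_max lexx orbT.
    have xt : `|x.2 - x'.2| <= `|x - x'| by rewrite prod_normE le_max lexx orbT.
    have h2 := mu_lip x.2 x'.2 (p + b *: y m) (p' + b' *: y m).
    rewrite opprD addrACA -scalerBl in h2.
    have h1 := mu_lip (`|b'| + x'.2) (`|b| + x.2) p' p.
    rewrite (distrC p') opprD [_ + _ + _]addrACA in h1.
    have h3 := ler_normD (p - p') ((b - b') *: y m); rewrite normrZ in h3.
    have h4 : `|b - b'| * `|y m| <= `|b - b'| * M by rewrite ler_wpM2l.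
    have h5 := ler_normD (`|b'| - `|b|) (x'.2 - x.2).
    have h6 := ler_dist_dist b' b; rewrite (distrC b') in h6.
    rewrite (distrC x'.2) in h5.
    have := ler_wpM2l M0 xb; have := ler_wpM2l M0 xt; have := ler_wpM2l M0 h5.
    have := ler_wpM2l M0 h6; lra.
  have fK x e' : L x -> 0 < e' -> \forall m \near free_ultra, - e' <= f m x.
    move=> [[/= Kp b1]]; rewrite in_itv/= => /andP[t0 t1] e'0.
    set p := x.1.1 in Kp *; set b := x.1.2.
    have h u : u = x.2 \/ u = - x.2 -> \forall m \near free_ultra,
        mu (`|b| + x.2) p - e' < T u (p + b *: y m).
      move=> ut; have := ushift_cvg yM (tail_norm_clip yM u) (a := b) (x := p).
      move=> /cvgr_gt; apply.
      apply: (@lt_le_trans _ _ (mu (`|b| + x.2) p)); first by rewrite gtrBl.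
      have := TD b u p; suff -> : `|u| = x.2 by [].
      by case: ut => ->; rewrite ?normrN ger0_norm.
    near=> m; rewrite /f -/p -/b lerBrDr addrC [X in _ <= X]/mu le_min.
    by apply/andP; split; apply: ltW; near: m; apply: h; [left|right].
  have H := compact_near_ultra cL fC fK e0.
  near=> m => p b Kp b1 t t01.
  have Hm : forall x, L x -> - e <= f m x by near: m.
  have : - e <= f m (p, b, t).
    by apply: Hm; split; [split|] => //=; rewrite in_itv/= -?ler_norml.
  by rewrite /f /=; lra.
have lam20 : 0 < lam / 2 by rewrite divr_gt0.
(* The errors add up to at most [lam / 2], so that half of [lam] remains. *)
have eps0 j : 0 < lam / 2 * 2 ^- j.+1 :> R.
  by rewrite mulr_gt0// invr_gt0 exprn_gt0.
have [m mP] := @greedy_choice _ _ y Q QK _ eps0.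
exists m, (lam / 2); split=> // k a.
set s := \sum_(i < k) `|a i|.
have : 0 <= s by rewrite sumr_ge0.
rewrite le_eqVlt => /predU1P[<-|s0]; first by rewrite mulr0.
(* Normalized to total mass 1: after [j] terms, [t] is the mass not yet used, and it vanishes at
   [j = k]. *)
pose b i : R := if (i < k)%N then a i / s else 0.
have bk : \sum_(i < k) `|b i| = 1.
  rewrite (eq_bigr (fun i : 'I_k => `|a i| / s)) => [|i _]; last first.
    by rewrite /b ltn_ord normrM normfV (gtr0_norm s0).
  by rewrite -mulr_suml divff ?gt_eqF.
have bj j : (j <= k)%N -> \sum_(i < j) `|b i| <= 1.
  move=> jk; rewrite -bk -!(big_mkord xpredT (fun i => `|b i|)).
  by rewrite (big_cat_nat (n := j) (p := k))//= lerDl sumr_ge0.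
have b1 i : `|b i| <= 1.
  rewrite /b; case: ifPn => ik; last by rewrite normr0.
  rewrite normrM normfV (gtr0_norm s0) ler_pdivrMr// mul1r.
  by rewrite /s (bigD1 (Ordinal ik))//= lerDl sumr_ge0.
have mu_ge j : (j <= k)%N -> lam - \sum_(i < j) lam / 2 * 2 ^- i.+1 <=
    mu (1 - \sum_(i < j) `|b i|) (\sum_(i < j) b i *: y (m i)).
  elim: j => [|j IH] jk.
    rewrite !big_ord0 !subr0 /mu le_min lexx /= -/lam.
    by rewrite -[X in T _ X]oppr0 tail_normN opprK.
  rewrite !big_ord_recr/=; have [t0 t1] : 0 <= 1 - (\sum_(i < j) `|b i| + `|b j|) /\
      1 - (\sum_(i < j) `|b i| + `|b j|) <= 1.
    have := bj _ jk; rewrite big_ord_recr/=.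
    have : 0 <= \sum_(i < j) `|b i| by rewrite sumr_ge0.
    by have := normr_ge0 (b j); lra.
  have := mP b b1 j (1 - (\sum_(i < j) `|b i| + `|b j|)).
  rewrite t0 t1 => /(_ isT); rewrite opprD addrCA (addrC _ (- `|b j|)) addNKr.
  by have := IH (ltnW jk); lra.
have := mu_ge k (leqnn k); rewrite bk subrr /mu oppr0 minxx.
have T0 p : T 0 p = `|p|.
  apply: ulimE; rewrite (_ : (fun _ => _) = (fun _ => `|p|)); first exact: cvg_cst.
  by apply/funext => n; rewrite scale0r addr0.
rewrite T0; have h1 := @geometric_eps (lam / 2) k lam20 => h2.
have e : \sum_(i < k) b i *: y (m i) = s^-1 *: \sum_(i < k) a i *: y (m i).
  rewrite scaler_sumr; apply: eq_bigr => i _.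
  by rewrite /b ltn_ord scalerA mulrC.
move: h2; rewrite e normrZ normfV (gtr0_norm s0) => h2.
by rewrite -ler_pdivlMr// mulrC; lra.
Unshelve. all: by end_near. Qed.

(** Upper bound: a further term with nonnegative coefficient hardly increases [T 1], which dominates
    the norm because [y] is weakly null; other combinations are split into positive and negative
    parts. Lower bound: partial sums almost increase in norm, and a term with coefficient of modulus
    1, of norm at least [lam / 2], is the difference of two of them. *)
Lemma c0_basic_sequence : 0 < T 1 0 -> weakly_cvg y 0 ->
    (forall a p, 0 <= a <= 1 -> D a 1 p <= T 1 p) ->
  exists (m : nat -> nat) (A B : R), [/\ 0 < A, 0 < B &
    forall k (a : nat -> R), (forall i, `|a i| <= 1) ->
    `|\sum_(i < k) a i *: y (m i)| <= B /\
    forall j, (j < k)%N -> `|a j| = 1 -> A <= `|\sum_(i < k) a i *: y (m i)|].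
Proof.
move=> lam0 y0 TD; set lam := T 1 0 in lam0.
have M0 : 0 <= M by exact: le_trans (yM 0).
pose Q e p a m := [/\ 0 <= a -> T 1 (p + a *: y m) <= T 1 p + e,
  `|p| - e <= `|p + a *: y m| & lam / 2 <= `|y m|].
have QK K e : compact K -> 0 < e -> \forall m \near free_ultra,
    forall p a, K p -> `|a| <= 1 -> Q e p a m.
  move=> cK e0.
  pose V : normedModType R := (X * R^o)%type.
  have dV (x x' : V) m : `|x.1 + x.2 *: y m - (x'.1 + x'.2 *: y m)| <=
      (1 + M) * `|x - x'|.
    have xp : `|x.1 - x'.1| <= `|x - x'| by rewrite prod_normE !le_max lexx.
    have xb : `|x.2 - x'.2| <= `|x - x'| by rewrite prod_normE !le_max lexx orbT.
    rewrite opprD addrACA -scalerBl mulrDl mul1r (le_trans (ler_normD _ _))//.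
    by rewrite lerD// normrZ mulrC ler_pM.
  pose f1 m (v : V) : R := T 1 v.1 - T 1 (v.1 + v.2 *: y m).
  pose f2 m (v : V) : R := `|v.1 + v.2 *: y m| - `|v.1|.
  have f1C m x x' : f1 m x - f1 m x' <= (2 + M) * `|x - x'|.
    have h1 := dV x' x m; rewrite (distrC x') in h1.
    have h2 := tail_norm_clip yM 1 x.1 x'.1.
    have h3 := tail_norm_clip yM 1 (x'.1 + x'.2 *: y m) (x.1 + x.2 *: y m).
    have xp : `|x.1 - x'.1| <= `|x - x'| by rewrite prod_normE !le_max lexx.
    by rewrite /f1; lra.
  have f2C m x x' : f2 m x - f2 m x' <= (2 + M) * `|x - x'|.
    have h1 := dV x x' m.
    have h2 := lerB_dist (x.1 + x.2 *: y m) (x'.1 + x'.2 *: y m).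
    have h3 := lerB_dist x'.1 x.1; rewrite distrC in h3.
    have xp : `|x.1 - x'.1| <= `|x - x'| by rewrite prod_normE !le_max lexx.
    by rewrite /f2; lra.
  have f1K (x : V) e' : (K `*` `[0, 1]) x -> 0 < e' ->
      \forall m \near free_ultra, - e' <= f1 m x.
    move=> [/= Kp]; rewrite in_itv/= => b01 e'0; set p := x.1; set b := x.2.
    have := ushift_cvg yM (tail_norm_clip yM 1) (a := b) (x := p).
    move=> /cvgr_lt/(_ (T 1 p + e'))/(_ _)H.
    near=> m; rewrite /f1 -/p -/b.
    suff : T 1 (p + b *: y m) < T 1 p + e' by lra.
    near: m; apply: H; rewrite (le_lt_trans (TD _ _ b01))// ltrDl//.
  have f2K (x : V) e' : (K `*` `[-1, 1]) x -> 0 < e' ->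
      \forall m \near free_ultra, - e' <= f2 m x.
    move=> _ e'0; set p := x.1; set b := x.2.
    have := tail_norm_cvg yM b p.
    move=> /cvgr_gt/(_ (`|p| - e'))/(_ _)H.
    near=> m; rewrite /f2 -/p -/b.
    suff : `|p| - e' < `|p + b *: y m| by lra.
    near: m; apply: H; apply: lt_le_trans (le_tail_norm yM y0 b p).
    by rewrite gtrBl.
  have cK1 : compact (K `*` `[-1, 1] : set V).
    by apply: compact_setX => //; exact: segment_compact.
  have cK0 : compact (K `*` `[0, 1] : set V).
    by apply: compact_setX => //; exact: segment_compact.
  have H1 := compact_near_ultra cK0 f1C f1K e0.
  have H2 := compact_near_ultra cK1 f2C f2K e0.
  have H3 : \forall m \near free_ultra, lam / 2 < `|0 + 1 *: y m|.
    by apply: (cvgr_gt _ (tail_norm_cvg yM 1 0)); rewrite -/lam; lra.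
  near=> m => p b Kp b1; split.
  - have Hm : forall x, (K `*` `[0, 1]) x -> - e <= f1 m x by near: m.
    move=> b0; have /Hm : (K `*` `[0, 1]) (p, b).
      by split=> //=; rewrite in_itv/= b0 (le_trans _ b1)// ler_norm.
    by rewrite /f1/=; lra.
  - have Hm : forall x, (K `*` `[-1, 1]) x -> - e <= f2 m x by near: m.
    have /Hm : (K `*` `[-1, 1]) (p, b).
      by split=> //=; rewrite in_itv/= -ler_norml.
    by rewrite /f2/=; lra.
  - have : lam / 2 < `|0 + 1 *: y m| by near: m.
    by rewrite add0r scale1r => /ltW.
(* The lower bound will be half of [lam / 2] minus the total error; an error of [lam / 8] leaves
   [lam / 8]. *)
have lam80 : 0 < lam / 8 by rewrite divr_gt0.
have eps0 j : 0 < lam / 8 * 2 ^- j.+1 :> R.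
  by rewrite mulr_gt0// invr_gt0 exprn_gt0.
have [m mP] := @greedy_choice _ _ y Q QK _ eps0.
have le_T k (a : nat -> R) : (forall i, 0 <= a i <= 1) ->
    `|\sum_(i < k) a i *: y (m i)| <= 2 * lam.
  move=> a01; have a1 i : `|a i| <= 1.
    by have /andP[a0 a1] := a01 i; rewrite ger0_norm.
  apply: le_trans (le_tail_norm yM y0 1 _) _.
  have h := @geometric_eps (lam / 8) k lam80.
  suff : T 1 (\sum_(i < k) a i *: y (m i)) <=
    lam + \sum_(i < k) lam / 8 * 2 ^- i.+1 by lra.
  elim: k {h} => [|j IH]; first by rewrite !big_ord0 addr0.
  rewrite !big_ord_recr/=; have [h _ _] := mP a a1 j.
  by have /andP[/h{}h _] := a01 j; lra.
exists m, (lam / 8), (4 * lam); split => // [|k a a1]; first by rewrite mulr_gt0.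
split.
  pose ap i := Num.max (a i) 0; pose an i := Num.max (- a i) 0.
  have ap01 i : 0 <= ap i <= 1.
    by rewrite le_max lexx orbT ge_max ler01 andbT (le_trans (ler_norm _)).
  have an01 i : 0 <= an i <= 1.
    rewrite le_max lexx orbT ge_max ler01 andbT (le_trans (ler_norm _))//.
    by rewrite normrN.
  have -> : \sum_(i < k) a i *: y (m i) =
      \sum_(i < k) ap i *: y (m i) - \sum_(i < k) an i *: y (m i).
    rewrite -sumrB; apply: eq_bigr => i _; rewrite -scalerBl; congr (_ *: _).
    rewrite /ap /an; have [a0|a0] := leP (a i) 0.
      by rewrite max_l ?oppr_ge0// sub0r opprK.
    by rewrite max_r ?subr0// oppr_le0 ltW.
  rewrite (le_trans (ler_normB _ _))//.
  by have := le_T k _ ap01; have := le_T k _ an01; lra.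
move=> j jk aj; pose P i := \sum_(i < i) a i *: y (m i).
(* With the accumulated error added, the norms of the partial sums are nondecreasing. *)
pose g i := `|P i| + \sum_(i < i) lam / 8 * 2 ^- i.+1.
have gm : {homo g : i j / (i <= j)%N >-> i <= j}.
  apply: homo_leq => [i|i i' i''|i]; [exact: lexx|exact: le_trans|].
  by rewrite /g /P !big_ord_recr/=; have [_ h _] := mP a a1 i; lra.
have Pk i : (i <= k)%N -> `|P i| <= `|P k| + lam / 8.
  move=> /gm; rewrite /g; have := @geometric_eps (lam / 8) k lam80.
  have : 0 <= \sum_(i < i) lam / 8 * 2 ^- i.+1.
    by apply: sumr_ge0 => l _; exact: ltW.
  lra.
have : `|a j *: y (m j)| <= `|P j.+1| + `|P j|.
  by rewrite (le_trans _ (ler_normB _ _))// /P big_ord_recr/= addrAC subrr add0r.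
rewrite normrZ aj mul1r; have [_ _ +] := mP a a1 j.
by have := Pk _ jk; have := Pk _ (ltnW jk); rewrite -/(P k); lra.
Unshelve. all: by end_near. Qed.

End BasicSequences.

(** * Isomorphic copies of l1 and c0 from estimates on finite sums *)

(** [c] gives the coordinates with respect to the basis [e], and the isomorphism sends [a] to the
    sum of the series of [c a i *: x i]. The upper estimate makes its partial sums Cauchy, and [X]
    is complete. *)
Lemma contains_isomorphic_basis (R : realType) (X : completeNormedModType R)
    (E : normedModType R) (e : nat -> E) (c : E -> nat -> R) (x : nat -> X)
    (A B : R) : 0 < A -> 0 < B ->
  (forall k a b i, c (k *: a + b) i = k * c a i + c b i) ->
  (forall a, \sum_(i < n) c a i *: e i @[n --> \oo] --> a) ->
  (forall n (a : nat -> R), A * `|\sum_(i < n) a i *: e i| <=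
    `|\sum_(i < n) a i *: x i| <= B * `|\sum_(i < n) a i *: e i|) ->
  contains_isomorphic X E.
Proof.
move=> A0 B0 cl ce AB.
pose S a n := \sum_(i < n) c a i *: x i.
(* A block of a series is a full sum with zero coefficients below [m], to which [AB] applies. *)
have cut (V : lmodType R) (v : nat -> V) (a : nat -> R) m n : (m <= n)%N ->
    \sum_(i < n) a i *: v i - \sum_(i < m) a i *: v i =
    \sum_(i < n) (if (i < m)%N then 0 else a i) *: v i.
  move=> mn; rewrite (big_ord_widen n (fun i => a i *: v i) mn) [X in _ - X]big_mkcond.
  by rewrite -sumrB; apply: eq_bigr => i _; case: ifP; rewrite ?subrr ?scale0r ?subr0.
have Sc a : cvgn (S a).
  apply/cauchy_cvgP/cauchy_exP => r r0.
  have r2 : 0 < r / (2 * B) by rewrite divr_gt0// mulr_gt0.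
  have /cvgrPdist_lt/(_ _ r2)[m _ hm] := ce a.
  exists (S a m); exists m => // n /= mn; rewrite -ball_normE/= distrC cut//.
  have /andP[_ h] := AB n (fun i => if (i < m)%N then 0 else c a i).
  apply: le_lt_trans h _; rewrite -cut// -ltr_pdivlMl//.
  have h1 := hm _ (leqnn m); have h2 := hm _ mn; rewrite /= in h1 h2.
  rewrite -(subrKA a) (le_lt_trans (ler_normD _ _))// distrC.
  have -> : B^-1 * r = r / (2 * B) + r / (2 * B) by field; rewrite gt_eqF.
  by rewrite ltrD.
have Tl : linear (fun a => limn (S a)).
  move=> k a b; apply: cvg_lim => //.
  rewrite (_ : S (k *: a + b) = (fun n => k *: S a n + S b n)).
    by apply: cvgD; [apply: cvgZl_tmp|]; exact: Sc.
  apply/funext => n; rewrite /S scaler_sumr -big_split; apply: eq_bigr => i _.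
  by rewrite cl scalerDl scalerA.
pose h := GRing.isLinear.Build _ _ _ _ _ Tl.
pose T : {linear E -> X} := HB.pack (fun a : E => limn (S a)) h.
exists T, A, B; split => // a.
have Ta : `|S a n| @[n --> \oo] --> `|T a| by apply: cvg_norm; exact: Sc.
have Ea (k : R) : k * `|\sum_(i < n) c a i *: e i| @[n --> \oo] --> k * `|a|.
  by apply: cvgMr; apply: cvg_norm; exact: ce.
apply/andP; split.
  apply: (ler_cvg_to (Ea A) Ta).
  by apply: nearW => n; have /andP[] := AB n (c a).
apply: (ler_cvg_to Ta (Ea B)).
by apply: nearW => n; have /andP[] := AB n (c a).
Qed.

Section L1Basis.
Variable R : realType.
Implicit Types (a : nat -> R) (u v : l1 R).

Lemma l1_sumE n a k : (\sum_(i < n) a i *: l1_basis R i : l1 R) k =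
  if (k < n)%N then a k else 0.
Proof.
elim: n => [|n IH]; first by rewrite big_ord0.
rewrite big_ord_recr/=.
rewrite -[LHS]/((\sum_(i < n) a i *: l1_basis R i : l1 R) k + a n * unit_vec R n k) IH.
rewrite /unit_vec ltnS; case: ltngtP => [_|_|->]; rewrite ?mulr0 ?addr0//.
by rewrite mulr1 add0r.
Qed.

Lemma l1_normE u n : (forall k, (n <= k)%N -> u k = 0) ->
  `|u| = \sum_(i < n) `|u i|.
Proof.
move=> u0; apply: cvg_lim => //; apply: cvg_near_cst; near=> k.
have nk : (n <= k)%N by near: k; exists n.
rewrite -[LHS]/(series (fun j => `|u j| : R) k) seriesEnat/=.
rewrite (big_cat_nat (n := n))//= big_mkord [X in _ + X]big1_seq ?addr0// => i.
by rewrite mem_index_iota => /andP[_ /andP[ni _]]; rewrite u0// normr0.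
Unshelve. all: by end_near. Qed.

Lemma l1_norm_sum n a : `|\sum_(i < n) a i *: l1_basis R i| = \sum_(i < n) `|a i|.
Proof.
rewrite (@l1_normE _ n) => [|k nk]; last by rewrite l1_sumE ltnNge nk.
by apply: eq_bigr => i _; rewrite l1_sumE ltn_ord.
Qed.

Lemma l1_normDs u v : (forall k, u k = 0 \/ v k = 0) -> `|u + v| = `|u| + `|v|.
Proof.
move=> uv; rewrite -[RHS]/(l1_norm u + l1_norm v) /l1_norm -lim_seriesD; [|exact: l1_cvg..].
congr (limn (series _)); apply/funext => k.
rewrite -[LHS]/(`|u k + v k| : R) -[RHS]/((`|u k| : R) + `|v k|).
by have [->|->] := uv k; rewrite !(addr0, add0r, normr0).
Qed.

(** Head and tail have disjoint supports, so the norm of the tail is [|u|] minus a partial sum of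
    the series defining [|u|]. *)
Lemma l1_sum_cvg u : \sum_(i < n) u i *: l1_basis R i @[n --> \oo] --> u.
Proof.
apply/cvgrPdist_le => /= e e0.
have nE n : `|u - \sum_(i < n) u i *: l1_basis R i| = `|u| - \sum_(i < n) `|u i|.
  set s := \sum_(i < n) _.
  have : `|s + (u - s)| = `|s| + `|u - s|.
    apply: l1_normDs => k; rewrite l1_sumE.
    rewrite -[X in _ \/ X = _]/(u k - s k) l1_sumE.
    by case: ifPn; [right; rewrite subrr|left].
  by rewrite addrC subrK l1_norm_sum => ->; rewrite addrAC subrr add0r.
have /cvgrPdist_le/(_ e e0)[N _ hN] := @l1_cvg R u.
exists N => // n /hN /=; rewrite nE.
have -> : \sum_(i < n) `|u i| = series (fun j => `|u j| : R) n by rewrite seriesEord.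
by apply: le_trans; exact: ler_norm.
Qed.

Lemma l1_contains (X : completeNormedModType R) (x : nat -> X) (A M : R) :
  0 < A -> (forall n, `|x n| <= M) ->
  (forall k a, A * \sum_(i < k) `|a i| <= `|\sum_(i < k) a i *: x i|) ->
  contains_isomorphic X (l1 R).
Proof.
move=> A0 xM Ax.
have M1 : 0 < `|M| + 1 by rewrite ltr_wpDl.
apply: (@contains_isomorphic_basis _ X _ (@l1_basis R) (fun u => u) x A (`|M| + 1)) => //.
  exact: l1_sum_cvg.
move=> n a; rewrite l1_norm_sum Ax/= mulr_sumr (le_trans (ler_norm_sum _ _ _))//.
apply: ler_sum => i _; rewrite normrZ mulrC ler_wpM2r//.
by rewrite (le_trans (xM _))// (le_trans (ler_norm _))// lerDl.
Qed.

End L1Basis.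

Section C0Basis.
Variable R : realType.
Implicit Types (a : nat -> R) (u v : c0 R).

Lemma c0_sumE n a k : (\sum_(i < n) a i *: c0_basis R i : c0 R) k =
  if (k < n)%N then a k else 0.
Proof.
elim: n => [|n IH]; first by rewrite big_ord0.
rewrite big_ord_recr/=.
rewrite -[LHS]/((\sum_(i < n) a i *: c0_basis R i : c0 R) k + a n * unit_vec R n k) IH.
rewrite /unit_vec ltnS; case: ltngtP => [_|_|->]; rewrite ?mulr0 ?addr0//.
by rewrite mulr1 add0r.
Qed.

Lemma c0_norm_attained n (a : nat -> R) : (0 < n)%N ->
  exists j : 'I_n, `|a j| = `|\sum_(i < n) a i *: c0_basis R i|.
Proof.
move=> n0; case: (@arg_maxP _ _ _ (Ordinal n0) xpredT (fun j => `|a j|)) => // j _ jm.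
exists j; apply/eqP; rewrite eq_le; apply/andP; split.
  by have := c0_norm_ge (\sum_(i < n) a i *: c0_basis R i) j; rewrite c0_sumE ltn_ord.
apply: c0_norm_le => k; rewrite c0_sumE.
by case: ifPn => [kn|_]; [exact: (jm (Ordinal kn))|rewrite normr0].
Qed.

Lemma c0_sum_cvg u : \sum_(i < n) u i *: c0_basis R i @[n --> \oo] --> u.
Proof.
apply/cvgrPdist_le => /= e e0.
have /asboolP/cvgrPdist_le/(_ e e0)[N _ uN] : `[< u n @[n --> \oo] --> (0 : R) >].
  exact: c0_valP.
near=> n; apply: c0_norm_le => k.
rewrite -[X in `|X|]/(u k - (\sum_(i < n) u i *: c0_basis R i : c0 R) k) c0_sumE.
case: ifPn => [_|kn]; first by rewrite subrr normr0 ltW.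
rewrite subr0; have := uN k; rewrite /= sub0r normrN; apply.
by rewrite -leqNgt in kn; apply: leq_trans kn; near: n; exists N.
Unshelve. all: by end_near. Qed.

(** By homogeneity the coefficients are divided by their largest modulus, which is attained at some
    index; both estimates are then instances of the hypothesis. *)
Lemma c0_contains (X : completeNormedModType R) (x : nat -> X) (A B : R) :
  0 < A -> 0 < B -> (forall k a, (forall i, `|a i| <= 1) ->
    `|\sum_(i < k) a i *: x i| <= B /\
    forall j, (j < k)%N -> `|a j| = 1 -> A <= `|\sum_(i < k) a i *: x i|) ->
  contains_isomorphic X (c0 R).
Proof.
move=> A0 B0 AB.
apply: (@contains_isomorphic_basis _ X _ (@c0_basis R) (fun u => u) x A B) => //.
  exact: c0_sum_cvg.
move=> n a.
have [s0|s0] := eqVneq (\sum_(i < n) a i *: c0_basis R i : c0 R) 0.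
  have a0 i : (i < n)%N -> a i = 0.
    by move=> ni; have := c0_sumE n a i; rewrite ni s0.
  by rewrite s0 normr0 !mulr0 big1 ?normr0 ?lexx// => i _; rewrite a0// scale0r.
set s := \sum_(i < n) _ in s0 *; pose m := `|s|.
have m0 : 0 < m by rewrite normr_gt0.
have am i : (i < n)%N -> `|a i| <= m.
  by move=> ni; have := c0_norm_ge s i; rewrite c0_sumE ni.
have [j am_j] : exists j : 'I_n, `|a j| = m.
  apply: c0_norm_attained; rewrite lt0n; apply: contra_neq s0 => n0.
  by rewrite /s big1// => i; have := ltn_ord i; rewrite {2}n0.
pose b i := if (i < n)%N then a i / m else 0.
have b1 i : `|b i| <= 1.
  rewrite /b; case: ifPn => [ni|_]; last by rewrite normr0.
  by rewrite normrM normfV (gtr0_norm m0) ler_pdivrMr// mul1r am.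
have e : \sum_(i < n) b i *: x i = m^-1 *: \sum_(i < n) a i *: x i.
  by rewrite scaler_sumr; apply: eq_bigr => i _; rewrite /b ltn_ord scalerA mulrC.
have [] := AB n b b1; rewrite e normrZ normfV (gtr0_norm m0) => h1 /(_ j (ltn_ord j)).
rewrite /b ltn_ord normrM normfV (gtr0_norm m0) am_j divff ?gt_eqF// => /(_ erefl) h2.
by move: h1 h2; rewrite ler_pdivrMl// ler_pdivlMl// mulrC => h1 h2; rewrite h1 andbT mulrC.
Qed.

End C0Basis.

(** * Subsequences that have a spreading model *)

(** Diagonal choice: [m j] realizes the limits of index at most [j] within [j.+1%:R^-1], and can be
    taken beyond its predecessor because the ultrafilter is free. *)
Lemma ultra_subsequence (R : realType) (phi : nat -> nat -> R) (l : nat -> R) :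
  (forall i, phi i n @[n --> free_ultra] --> l i) ->
  exists m : nat -> nat, (forall j, (m j < m j.+1)%N) /\
    forall i, phi i (m j) @[j --> \oo] --> l i.
Proof.
move=> phil.
have /choice[g gP] (u : nat * nat) : exists n, (u.2 < n)%N /\
    forall i : 'I_u.1.+1, `|l i - phi i n| < u.1.+1%:R^-1.
  have H : \forall n \near free_ultra,
      forall i : 'I_u.1.+1, `|l i - phi i n| < u.1.+1%:R^-1.
    apply: filter_forall => i; have /cvgrPdist_lt := phil i; apply.
    by rewrite invr_gt0.
  have H' : \forall n \near free_ultra, (u.2 < n)%N.
    by apply: free_ultra_oo; exists u.2.+1.
  exact: filter_ex (filterI H' H).
pose m := fix m j := if j is j'.+1 then g (j, m j') else g (0, 0).
have mP j : forall i : 'I_j.+1, `|l i - phi i (m j)| < j.+1%:R^-1.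
  by case: j => [|j]; [exact: (gP (0, 0)).2|exact: (gP (j.+1, m j)).2].
exists m; split => [j|i]; first exact: (gP (j.+1, m j)).1.
apply/cvgrPdist_lt => e e0; near=> j.
have ij : (i < j.+1)%N by near: j; exists i.
apply: lt_trans (mP j (Ordinal ij)) _; near: j.
exact: near_infty_natSinv_lt (PosNum e0).
Unshelve. all: by end_near. Qed.

Lemma rat_approx (R : realType) (a e : R) : 0 < e ->
  exists r : rat, `|a - ratr r| < e.
Proof.
move=> e0; have [|r] := @rat_in_itvoo R (a - e) (a + e); first by lra.
by rewrite in_itv/= => ?; exists r; rewrite ltr_distlC.
Qed.

Section SpreadingSubsequence.
Variables (R : realType) (X : normedModType R) (y : nat -> X) (M : R).
Variables (N : X -> R) (C : R).
Hypothesis yM : forall n, `|y n| <= M.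
Hypothesis cN : clip C N.
Local Notation iter := (iter_ushift y).

Let M0 : 0 <= M. Proof. exact: le_trans (yM 0). Qed.

Let C_le : C <= `|C|. Proof. exact: ler_norm. Qed.

Let iter_clip s x a n x' a' :
  iter s N (x + a *: y n) - iter s N (x' + a' *: y n) <=
  `|C| * (`|x - x'| + `|a - a'| * M).
Proof.
apply: le_trans (iter_ushift_clip yM s cN _ _) _.
apply: (le_trans (ler_wpM2r (normr_ge0 _) C_le)); rewrite ler_wpM2l//.
rewrite opprD addrACA -scalerBl (le_trans (ler_normD _ _))// lerD2l.
by rewrite normrZ ler_wpM2l.
Qed.

Let iter_close s q x a x' a' e e' :
  (forall z, `|iter s N z - iter q N z| <= e) ->
  `|C| * (`|x - x'| + `|a - a'| * M) <= e' ->
  (forall n, `|iter s N (x + a *: y n) - iter q N (x' + a' *: y n)| <= e + e') /\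
  `|iter (a :: s) N x - iter (a' :: q) N x'| <= e + e'.
Proof.
move=> sq xx'; have h n : `|iter s N (x + a *: y n) - iter q N (x' + a' *: y n)| <= e + e'.
  rewrite -(subrKA (iter s N (x' + a' *: y n))) addrC (le_trans (ler_normD _ _))// lerD//.
  apply: le_trans xx'; rewrite ler_norml lerNl opprB iter_clip andbT.
  by rewrite (distrC x) (distrC a) iter_clip.
split=> //; have cs := iter_ushift_clip yM s cN; have cq := iter_ushift_clip yM q cN.
rewrite ler_norml lerNl opprB !lerBlDl ![_ + (e + e')]addrC /=.
apply/andP; split; rewrite addrC.
- apply: (ushift_le yM cq cs); apply: nearW => n; have := h n.
  by rewrite ler_norml => /andP[+ _]; lra.
- apply: (ushift_le yM cs cq); apply: nearW => n; have := h n.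
  by rewrite ler_norml => /andP[_]; lra.
Qed.

(** Uniformity in [x] lets the approximation pass under the next limit, where [x] is shifted by
    multiples of the [y n]. *)
Lemma iter_ushift_approx s e : 0 < e -> exists q : seq rat,
  forall x, `|iter s N x - iter (map ratr q) N x| <= e.
Proof.
elim: s e => [|a s IH] e e0.
  by exists [::] => x; rewrite subrr normr0 ltW.
have [|q qP] := IH (e / 2); first by rewrite divr_gt0.
have D0 : 0 < `|C| * M + 1 by rewrite ltr_wpDl// mulr_ge0.
have [|r ar] := @rat_approx _ a (e / 2 / (`|C| * M + 1)).
  by rewrite !divr_gt0.
have h : `|C| * (`|a - ratr r| * M) <= e / 2.
  rewrite mulrCA; apply: (@le_trans _ _ (`|a - ratr r| * (`|C| * M + 1))).
    by rewrite ler_wpM2l// lerDl.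
  by rewrite -ler_pdivlMr// ltW.
exists (r :: q) => x; have [||_] := @iter_close s (map ratr q) x a x (ratr r) (e / 2) (e / 2).
- exact: qP.
- by rewrite subrr normr0 add0r.
- by rewrite -splitr.
Qed.

(** Along [m] the ordinary iterated limits equal those of the whole [y] along the ultrafilter. It is
    enough to arrange this for countably many data, a point [d k] and rational coefficients, since
    the expressions are Lipschitz in the point and depend continuously on the coefficients. *)
Lemma spreading_subsequence (d : nat -> X) :
  (forall x e, 0 < e -> exists n, `|x - d n| < e) ->
  exists m : nat -> nat, (forall j, (m j < m j.+1)%N) /\
    forall a x, iterated_lim N (y \o m) a x (iter a N x).
Proof.
move=> dd.
pose I := (nat * rat * seq rat)%type.
(* A number that codes no triple gets the constant 0, for which convergence is trivial. *)
pose phi i n : R := if unpickle i is Some (k, r, q) then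
  iter (map ratr q) N (d k + ratr r *: y n) else 0.
pose l i : R := if unpickle i is Some (k, r, q) then
  iter (map ratr (r :: q)) N (d k) else 0.
have [i|m [mm mP]] := @ultra_subsequence R phi l.
  rewrite /phi /l; case: unpickle => [[[k r] q]|]; last exact: cvg_cst.
  exact: (ushift_cvg yM (iter_ushift_clip yM _ cN)).
exists m; split=> // a; elim: a => [//|a s IH] x /=.
exists (fun j => iter s N (x + a *: y (m j))); split=> [j|]; first exact: IH.
apply/cvgrPdist_le => e e0.
have e4 : 0 < e / 4 by rewrite divr_gt0.
have e8 : 0 < e / 8 by rewrite divr_gt0.
have [q qP] := iter_ushift_approx s e8.
have D0 : 0 < `|C| * M + 1 by rewrite ltr_wpDl// mulr_ge0.
have D1 : 0 < `|C| + 1 by rewrite ltr_wpDl.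
have [|r ar] := @rat_approx _ a (e / 8 / 2 / (`|C| * M + 1)).
  by rewrite !divr_gt0.
have [|k xk] := dd x (e / 8 / 2 / (`|C| + 1)); first by rewrite !divr_gt0.
have h1 : `|C| * (`|a - ratr r| * M) <= e / 8 / 2.
  rewrite mulrCA; apply: (@le_trans _ _ (`|a - ratr r| * (`|C| * M + 1))).
    by rewrite ler_wpM2l// lerDl.
  by rewrite -ler_pdivlMr// ltW.
have h2 : `|C| * `|x - d k| <= e / 8 / 2.
  rewrite mulrC; apply: (@le_trans _ _ (`|x - d k| * (`|C| + 1))).
    by rewrite ler_wpM2l// lerDl.
  by rewrite -ler_pdivlMr// ltW.
have [||h3 h4] := @iter_close s (map ratr q) x a (d k) (ratr r) (e / 8) (e / 8).
- exact: qP.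
- by rewrite mulrDr [leRHS]splitr lerD.
have := mP (pickle (k, r, q)); rewrite /phi /l pickleK => /cvgrPdist_lt/(_ _ e4).
apply: filterS => j; have := h3 (m j); move: h4; rewrite /= -/(iter s).
rewrite !ltr_norml !ler_norml => /andP[? ?] /andP[? ?] /andP[? ?].
by apply/andP; split; lra.
Qed.

Definition spreading_norm (p : c00 R) : R := iter p N 0.

Lemma iter_ushift_nseq0 s k x : iter (s ++ nseq k 0) N x = iter s N x.
Proof.
elim: s x => [|a s IH] x /=; last by congr ulim; apply/funext => n.
elim: k x => //= k IH x; apply: ulimE.
rewrite (_ : (fun _ => _) = (fun _ => N x)); first exact: cvg_cst.
by apply/funext => n; rewrite scale0r addr0 IH.
Qed.

(** [Poly] strips trailing zeros; a zero coefficient only adds the limit of a constant, so the value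
    does not depend on the list that represents the element. *)
Lemma spreading_normE s : spreading_norm (Poly s) = iter s N 0.
Proof.
rewrite /spreading_norm -(iter_ushift_nseq0 _ (size s - size (Poly s))).
congr (iter _ N 0); apply: (@eq_from_nth _ 0) => [|i].
  by rewrite size_cat size_nseq subnKC// size_Poly.
rewrite size_cat size_nseq subnKC ?size_Poly// => si.
rewrite nth_cat; case: ltnP => h; first by rewrite coef_Poly.
by rewrite nth_nseq if_same -coef_Poly nth_default.
Qed.

End SpreadingSubsequence.

(** * Block sequences and James' distortion *)

(** [k] is the supremum of the infima of the decreasing sets [S n]: it bounds each infimum from
    above and is approached by them. *)
Lemma stabilized_inf (R : realType) (S : nat -> set R) (c C : R) :
  (forall n, S n !=set0) -> (forall n n', (n <= n')%N -> S n' `<=` S n) ->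
  (forall n x, S n x -> c <= x <= C) ->
  exists k, [/\ c <= k, forall n e, 0 < e -> exists2 x, S n x & x <= k + e &
    forall e, 0 < e -> exists n, forall x, S n x -> k - e <= x].
Proof.
move=> S0 Sm Sb.
have lb n : has_inf (S n) by split=> //; exists c => x /Sb/andP[].
have iC n : inf (S n) <= C.
  have [x Sx] := S0 n; have /andP[_ xC] := Sb n x Sx.
  by apply: le_trans xC; apply: ge_inf => //; exact: (lb n).2.
have hs : has_sup (range (fun n => inf (S n))).
  by split; [exists (inf (S 0)), 0|exists C => _ [n _ <-]].
exists (sup (range (fun n => inf (S n)))); split.
- apply: (@le_trans _ _ (inf (S 0))).
    by apply: lb_le_inf => // x /Sb/andP[].
  by apply: sup_upper_bound => //; exists 0.
- move=> n e e0; have [x Sx xe] := inf_adherent e0 (lb n).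
  exists x => //; apply: le_trans (ltW xe) _; rewrite lerD2r.
  by apply: sup_upper_bound => //; exists n.
- move=> e e0; have [_ [n _ <-] ne] := sup_adherent e0 hs.
  exists n => x Sx; apply: le_trans (ltW ne) _.
  by apply: ge_inf => //; exact: (lb n).2.
Qed.

Section Blocks.
Variables (R : realType) (E : normedModType R).
Variables (co : E -> nat -> R) (e : nat -> E).
Hypothesis coP : forall k a b i, co (k *: a + b) i = k * co a i + co b i.
Hypothesis e1 : forall i, `|e i| = 1.
Hypothesis coe : forall i k, k != i -> co (e i) k = 0.

Definition supported n m (w : E) :=
  forall i, (i < n)%N || (m <= i)%N -> co w i = 0.

Lemma supportedW n n' m m' w : (n' <= n)%N -> (m <= m')%N ->
  supported n m w -> supported n' m' w.
Proof.
move=> nn mm sw i /orP[i1|i1]; apply: sw.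
  by rewrite (leq_trans i1 nn).
by rewrite (leq_trans mm i1) orbT.
Qed.

(* James' argument: the infima of H over the normalized vectors supported after n
   increase to k, so far blocks can be chosen that almost realize k. *)
Lemma stabilizing_blocks (H : E -> R) (c C : R) :
  (forall w, `|w| = 1 -> c <= H w <= C) ->
  exists (k : R) (p : nat -> nat) (u : nat -> E),
  [/\ c <= k, forall i j, (i <= j)%N -> (p i <= p j)%N,
    forall j, `|u j| = 1 /\ supported (p j) (p j.+1) (u j) &
    forall d, 0 < d -> exists J,
      (forall j, (J <= j)%N -> H (u j) <= k + d) /\
      forall w m, `|w| = 1 -> supported (p J) m w -> k - d <= H w].
Proof.
move=> HcC.
pose S n := [set H w | w in [set w | `|w| = 1 /\ exists m, supported n m w]].
have [||n x|k [ck kS Sk]] := @stabilized_inf R S c C.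
- move=> n; exists (H (e n)), (e n) => //; split=> //; exists n.+1 => i hi.
  by apply: coe; apply: contraTneq hi => ->; rewrite !ltnn.
- move=> n n' nn' _ [w [w1 [m sw]] <-]; exists w => //; split => //.
  by exists m; exact: supportedW sw.
- by move=> [w [w1 _] <-]; exact: HcC.
have /choice[g gP] n : exists wm : E * nat, [/\ `|wm.1| = 1,
    supported n wm.2 wm.1, (n < wm.2)%N & H wm.1 <= k + n.+1%:R^-1].
  have [|_ [w [w1 [m sw]] <-] Hw] := kS n n.+1%:R^-1; first by rewrite invr_gt0.
  (* The end of the support is moved beyond [n], so that the block boundaries increase strictly. *)
  exists (w, maxn m n.+1); split => //=; last exact: leq_maxr.
  by apply: supportedW sw => //; exact: leq_maxl.
pose p j := iter j (fun n => (g n).2) 0.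
have pS j : (p j < p j.+1)%N by rewrite /p iterS; have [] := gP (iter j (fun n => (g n).2) 0).
have pm i j : (i <= j)%N -> (p i <= p j)%N.
  by apply: (homo_leq leqnn leq_trans) => {}i; exact: ltnW.
have jp j : (j <= p j)%N by elim: j => // j IH; exact: leq_ltn_trans (pS j).
exists k, p, (fun j => (g (p j)).1); split => // [j|d d0].
  by have [] := gP (p j).
have [n nS] := Sk d d0.
have [m md] : exists m : nat, m.+1%:R^-1 < d.
  exact: filter_ex (near_infty_natSinv_lt (PosNum d0)).
exists (maxn n m); split => [j Jj|w q w1 sw].
  have [_ _ _ /le_trans] := gP (p j); apply; rewrite lerD2l.
  apply: le_trans (ltW md); rewrite lef_pV2 ?posrE// ler_nat ltnS.
  by apply: leq_trans (jp j); apply: leq_trans Jj; exact: leq_maxr.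
apply: nS; exists w => //; split=> //; exists q; apply: supportedW sw => //.
by apply: leq_trans (jp _); exact: leq_maxl.
Qed.

(** Strictly increasing lists of indices from [J] on are what an iterated limit meets when its
    indices are fixed one after another. Combinations are therefore written as lists of pairs of a
    coefficient and an index. *)
Fixpoint increasing_from J (s : seq nat) : bool :=
  if s is h :: t then (J <= h)%N && increasing_from h.+1 t else true.

Lemma increasing_from_ge J s h : increasing_from J s -> h \in s -> (J <= h)%N.
Proof.
elim: s J => // i s IH J /= /andP[Ji si]; rewrite inE => /predU1P[->//|hs].
by apply: leq_trans Ji _; apply: ltnW; exact: IH si hs.
Qed.

Variables (p : nat -> nat) (u : nat -> E).
Hypothesis pm : forall i j, (i <= j)%N -> (p i <= p j)%N.
Hypothesis su : forall j, supported (p j) (p j.+1) (u j).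

Lemma supported_block_sum J (l : seq (R * nat)) :
  increasing_from J (map snd l) ->
  exists m, supported (p J) m (\sum_(q <- l) q.1 *: u q.2).
Proof.
have co0 i : co 0 i = 0.
  by have := coP 1 0 0 i; rewrite scaler0 addr0 mul1r -[LHS]addr0 => /addrI.
elim: l J => [|[a h] l IH] J /=.
  by exists 0 => i _; rewrite big_nil.
move=> /andP[Jh /IH[m sm]]; exists (maxn m (p h.+1)) => i hi.
rewrite big_cons coP [co (u h) i]su ?mulr0 ?add0r.
  apply: sm; case/orP: hi => [hi|]; last by rewrite geq_max => /andP[-> _]; rewrite orbT.
  by rewrite (leq_trans hi)// pm// (leq_trans Jh).
case/orP: hi => [hi|]; last by rewrite geq_max => /andP[_ ->]; rewrite orbT.
by rewrite (leq_trans hi)// pm.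
Qed.

End Blocks.

Lemma norm_l1_basis (R : realType) i : `|l1_basis R i| = 1.
Proof.
rewrite (@l1_normE _ _ i.+1) => [|k ik]; last by rewrite /= /unit_vec gtn_eqF.
rewrite big_ord_recr/= {2}/unit_vec eqxx normr1 big1 ?add0r// => k _.
by rewrite /unit_vec ltn_eqF// normr0.
Qed.

Lemma norm_c0_basis (R : realType) i : `|c0_basis R i| = 1.
Proof.
apply/eqP; rewrite eq_le; apply/andP; split; last first.
  by have := c0_norm_ge (c0_basis R i) i; rewrite /= /unit_vec eqxx normr1.
by apply: c0_norm_le => k; rewrite /= /unit_vec; case: eqP; rewrite ?normr1 ?normr0.
Qed.

Lemma l1_block_sum (R : realType) (p : nat -> nat) (u : nat -> l1 R) J
    (l : seq (R * nat)) :
  (forall i j, (i <= j)%N -> (p i <= p j)%N) -> (forall j, `|u j| = 1) ->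
  (forall j, supported (fun w : l1 R => w) (p j) (p j.+1) (u j)) ->
  increasing_from J (map snd l) ->
  `|\sum_(q <- l) q.1 *: u q.2| = \sum_(q <- l) `|q.1|.
Proof.
move=> pm u1 su; elim: l J => [|[a h] l IH] J; first by rewrite !big_nil normr0.
move=> /= /andP[_ hl]; rewrite !big_cons -(IH _ hl) /=.
have -> : `|a| = `|a *: u h| by rewrite normrZ u1 mulr1.
have [//|m sm] := @supported_block_sum _ _ (fun w : l1 R => w) _ p u pm su _ _ hl.
apply: l1_normDs => k; have [hk|hk] := leqP (p h.+1) k; [left|right].
  by rewrite -[LHS]/(a * u h k) su ?mulr0// hk orbT.
by apply: sm; rewrite hk.
Qed.

Lemma c0_block_sum (R : realType) (p : nat -> nat) (u : nat -> c0 R) J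
    (l : seq (R * nat)) (m : R) : 0 <= m ->
  (forall i j, (i <= j)%N -> (p i <= p j)%N) -> (forall j, `|u j| = 1) ->
  (forall j, supported (fun w : c0 R => w) (p j) (p j.+1) (u j)) ->
  increasing_from J (map snd l) -> (forall q, q \in l -> `|q.1| <= m) ->
  `|\sum_(q <- l) q.1 *: u q.2| <= m.
Proof.
move=> m0 pm u1 su; elim: l J => [|[a h] l IH] J; first by rewrite !big_nil normr0.
move=> /= /andP[_ hl] lm; rewrite !big_cons.
have [//|m' sm] := @supported_block_sum _ _ (fun w : c0 R => w) _ p u pm su _ _ hl.
have {}IH := IH _ hl (fun q ql => lm q (mem_behead (s := (a, h) :: l) ql)).
set s := \sum_(q <- l) _ in sm IH *; apply: c0_norm_le => k.
rewrite -[X in `|X|]/(a * u h k + s k); have [hk|hk] := leqP (p h.+1) k.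
  rewrite su ?mulr0 ?add0r; last by rewrite hk orbT.
  by apply: le_trans IH; exact: c0_norm_ge.
rewrite sm ?hk// addr0 normrM -[leRHS]mulr1 ler_pM//.
  by have := lm _ (mem_head _ _).
by rewrite -(u1 h); exact: c0_norm_ge.
Qed.

Section Distortion.
Variables (R : realType) (X : normedModType R) (N : X -> R).
Hypothesis N_norm : equivalent_norm N.

Let NZ (k : R) x : N (k *: x) = `|k| * N x. Proof. by have [_ ->] := N_norm. Qed.

Let N0 : N 0 = 0.
Proof. exact: sublinear0 (equivalent_norm_sublinear N_norm). Qed.

Lemma equivalent_norm_sum (l : seq (R * nat)) (v : nat -> X) :
  N (\sum_(q <- l) q.1 *: v q.2) <= \sum_(q <- l) `|q.1| * N (v q.2).
Proof.
have sN := equivalent_norm_sublinear N_norm.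
elim: l => [|[a h] l IH]; first by rewrite !big_nil (sublinear0 sN).
by rewrite !big_cons (le_trans (sN.1 _ _))// NZ lerD2l.
Qed.

Lemma composed_norm_bounds (E : normedModType R) (T : {linear E -> X}) (A B : R) :
  0 < A -> 0 < B -> (forall a, A * `|a| <= `|T a| <= B * `|a|) ->
  exists c C, [/\ 0 < c, 0 < C & forall w, c * `|w| <= N (T w) <= C * `|w|].
Proof.
move=> A0 B0 AB; have [_ _ _ [A' [B' [A'0 B'0 AB']]]] := N_norm.
exists (A' * A), (B' * B); split=> [||w]; rewrite ?mulr_gt0//.
have /andP[h1 h2] := AB w; have /andP[h3 h4] := AB' (T w); apply/andP; split.
  by rewrite (le_trans _ h3)// -mulrA ler_pM2l.
by rewrite (le_trans h4)// -mulrA ler_pM2l.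
Qed.

Lemma normalize_block_sum (E : normedModType R) (T : {linear E -> X}) (u : nat -> E)
    (l : seq (R * nat)) :
  \sum_(q <- l) q.1 *: ((N (T (u q.2)))^-1 *: T (u q.2)) =
  T (\sum_(q <- [seq (q.1 / N (T (u q.2)), q.2) | q <- l]) q.1 *: u q.2).
Proof.
rewrite big_map linear_sum; apply: eq_bigr => -[a h] _ /=.
by rewrite [RHS]linearZ/= scalerA.
Qed.

Lemma normalize_gt0 x : 0 < N x -> N ((N x)^-1 *: x) = 1.
Proof. by move=> x0; rewrite NZ normfV gtr0_norm// mulVf ?gt_eqF. Qed.

(** Far out, [N \o T] is at most [k + d] on the [u j] and at least [k - d] on normalized
    combinations of them. Normalizing the [u j] for [N] gives the ratio [(k - d) / (k + d)], which
    is at least [1 - e] for [d = k * e / 2]. *)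
Lemma l1_distortion : contains_isomorphic X (l1 R) ->
  exists v : nat -> X, normalized N v /\ forall e, 0 < e <= 1 ->
  exists J, forall l, increasing_from J (map snd l) ->
  (1 - e) * \sum_(q <- l) `|q.1| <= N (\sum_(q <- l) q.1 *: v q.2).
Proof.
move=> [T [A [B [A0 B0 /(composed_norm_bounds A0 B0)[c [C [c0 C0 cC]]]]]]].
pose G w := N (T w).
have [|i m /negbTE mi|w w1|k [p [u [ck pm up kP]]]] :=
    @stabilizing_blocks R (l1 R) (fun u => u) (@l1_basis R) _ _ G c C.
- exact: norm_l1_basis.
- by rewrite /= /unit_vec mi.
- by have := cC w; rewrite w1 !mulr1.
have k0 : 0 < k by exact: lt_le_trans ck.
have Gu j : 0 < G (u j).
  by have [u1 _] := up j; have /andP[+ _] := cC (u j); rewrite u1 mulr1; exact: lt_le_trans.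
exists (fun j => (G (u j))^-1 *: T (u j)); split => [j|e /andP[e0 e1]].
  by rewrite normalize_gt0//; exact: Gu.
have d0 : 0 < k * e / 2 by rewrite divr_gt0// mulr_gt0.
have [J [Ju Jw]] := kP _ d0; exists J => l lJ.
rewrite normalize_block_sum; set l' := map _ _; set w := \sum_(q <- l') _.
have l'J : increasing_from J (map snd l') by rewrite -map_comp.
have wl : `|w| = \sum_(q <- l') `|q.1|.
  by apply: (@l1_block_sum R p u J l') => // j; [exact: (up j).1|exact: (up j).2].
have h1 : (k - k * e / 2) * `|w| <= G w.
  have [->|w0] := eqVneq w 0; first by rewrite normr0 mulr0 /G linear0 N0.
  have [//|m sm] := @supported_block_sum _ _ (fun w : l1 R => w) _ p u pm (fun j => (up j).2) _ _ l'J.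
  have w1 : `| `|w|^-1 *: w| = 1 by rewrite normrZ normfV normr_id mulVf ?normr_eq0.
  have sw : supported (fun w : l1 R => w) (p J) m (`|w|^-1 *: w).
    by move=> i hi; rewrite -[LHS]/(`|w|^-1 * w i) [w i]sm ?mulr0.
  have := Jw _ m w1 sw; rewrite /G.
  have := NZ `|w|^-1 (T w); rewrite -linearZ => ->; rewrite normfV normr_id.
  by rewrite ler_pdivlMl ?normr_gt0// mulrC.
have kd : 0 < k + k * e / 2 by rewrite addr_gt0.
have h2 : (k + k * e / 2)^-1 * \sum_(q <- l) `|q.1| <= `|w|.
  rewrite wl mulr_sumr big_map big_seq [leRHS]big_seq; apply: ler_sum => -[a h] ah /=.
  rewrite normrM normfV (gtr0_norm (Gu h)).
  rewrite mulrC ler_wpM2l// lef_pV2 ?posrE//.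
  by apply: Ju; apply: (increasing_from_ge lJ); apply/mapP; exists (a, h).
have kd' : 0 <= k - k * e / 2 by nra.
apply: le_trans h1; apply: le_trans (ler_wpM2l kd' h2).
rewrite mulrA ler_wpM2r ?sumr_ge0// ler_pdivlMr//.
by nra.
Qed.

(** Stabilization is applied to the opposite of [N \o T], that is, to its suprema, because in c0
    combinations of blocks are estimated from above. The ratio [(- k + d) / (- k - d)] is at most
    [1 + e] for [d = - k * e / 3] and [e <= 1]. *)
Lemma c0_distortion : contains_isomorphic X (c0 R) ->
  exists v : nat -> X, normalized N v /\ forall e, 0 < e <= 1 ->
  exists J, forall l m, 0 <= m -> increasing_from J (map snd l) ->
  (forall q, q \in l -> `|q.1| <= m) ->
  N (\sum_(q <- l) q.1 *: v q.2) <= (1 + e) * m.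
Proof.
move=> [T [A [B [A0 B0 /(composed_norm_bounds A0 B0)[c [C [c0' C0 cC]]]]]]].
pose G w := N (T w).
have [|i m /negbTE mi|w w1|k [p [u [_ pm up kP]]]] :=
    @stabilizing_blocks R (c0 R) (fun u => u) (@c0_basis R) _ _ (fun w => - G w) (- C) (- c).
- exact: norm_c0_basis.
- by rewrite /= /unit_vec mi.
- by have := cC w; rewrite w1 !mulr1 !lerN2 andbC.
have Gu j : c <= G (u j).
  by have [u1 _] := up j; have /andP[] := cC (u j); rewrite u1 mulr1.
have Gu0 j : 0 < G (u j) by exact: lt_le_trans (Gu j).
(* Otherwise the lower estimate [Jw], applied to the block [u J] itself, contradicts [Gu J]. *)
have k0 : k <= - c.
  rewrite leNgt; apply/negP => kc; have d0 : 0 < (k + c) / 2 by rewrite divr_gt0//; lra.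
  have [J [_ Jw]] := kP _ d0; have [u1 su] := up J.
  by have := Jw _ _ u1 su; have := Gu J; lra.
exists (fun j => (G (u j))^-1 *: T (u j)); split => [j|e /andP[e0 e1]].
  by rewrite normalize_gt0//; exact: Gu0.
have d0 : 0 < - k * e / 3 by rewrite divr_gt0// mulr_gt0//; lra.
have [J [Ju Jw]] := kP _ d0; exists J => l m m0 lJ lm.
rewrite normalize_block_sum; set l' := map _ _; set w := \sum_(q <- l') _.
have l'J : increasing_from J (map snd l') by rewrite -map_comp.
have kd : 0 < - k - - k * e / 3 by nra.
have wl : `|w| <= m / (- k - - k * e / 3).
  apply: (@c0_block_sum R p u J l') => //; first by rewrite divr_ge0// ltW.
  - by move=> j; exact: (up j).1.
  - by move=> j; exact: (up j).2.
  - move=> _ /mapP[[a h] ah ->] /=; rewrite normrM normfV (gtr0_norm (Gu0 h)).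
    apply: ler_pM => //; rewrite ?invr_ge0 ?(ltW (Gu0 h))//; first exact: (lm (a, h)).
    rewrite lef_pV2 ?posrE//.
    suff : - G (u h) <= k + - k * e / 3 by rewrite /G; lra.
    by apply: Ju; apply: (increasing_from_ge lJ); apply/mapP; exists (a, h).
have h1 : G w <= (- k + - k * e / 3) * `|w|.
  have [->|w0] := eqVneq w 0; first by rewrite normr0 mulr0 /G linear0 N0.
  have [//|q sm] := @supported_block_sum _ _ (fun w : c0 R => w) _ p u pm (fun j => (up j).2) _ _ l'J.
  have w1 : `| `|w|^-1 *: w| = 1 by rewrite normrZ normfV normr_id mulVf ?normr_eq0.
  have sw : supported (fun w : c0 R => w) (p J) q (`|w|^-1 *: w).
    by move=> i hi; rewrite -[LHS]/(`|w|^-1 * w i) [w i]sm ?mulr0.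
  have := Jw _ q w1 sw; rewrite /G.
  have := NZ `|w|^-1 (T w); rewrite -linearZ => ->; rewrite normfV normr_id => h.
  by rewrite -ler_pdivrMr ?normr_gt0// mulrC; lra.
apply: le_trans h1 _.
have kd' : 0 <= - k + - k * e / 3 by nra.
apply: le_trans (ler_wpM2l kd' wl) _.
rewrite mulrCA mulrC ler_wpM2r// ler_pdivrMr//.
by nra.
Qed.

End Distortion.

(** * Bounds on iterated limits and weakly null sequences *)

Section SpreadingModels.
Variables (R : realType) (X : normedModType R) (N : X -> R).
Hypothesis N_norm : equivalent_norm N.

Lemma equivalent_norm_clip : exists C, clip C N.
Proof.
have [_ _ _ [A [B [_ _ AB]]]] := N_norm.
exists B; apply: clip_sublinear; first exact: equivalent_norm_sublinear.
by move=> x; have /andP[] := AB x.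
Qed.

Lemma normalized_bounded y : normalized N y -> exists M, forall n, `|y n| <= M.
Proof.
have [_ _ _ [A [B [A0 _ AB]]]] := N_norm => yN.
by exists (A^-1 * 1) => n; rewrite -(yN n) ler_pdivlMl//; have /andP[] := AB (y n).
Qed.

Lemma linear_le_norm (phi : {linear X -> R^o}) : continuous phi ->
  exists K, 0 < K /\ forall x, `|phi x| <= K * N x.
Proof.
move=> cphi; have [_ _ _ [A [B [A0 _ AB]]]] := N_norm.
have [K K0 Kphi] : exists2 K, 0 < K & forall x, `|phi x| <= K * `|x|.
  have /linear_boundedP/pinfty_ex_gt0[K K0 h] := continuous_linear_bounded 0 (cphi 0).
  by exists K.
exists (K / A); split=> [|x]; first by rewrite divr_gt0.
apply: le_trans (Kphi x) _; rewrite -mulrA ler_pM2l// ler_pdivlMl//.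
by have /andP[] := AB x.
Qed.

(** In each successive limit the index can be taken among those with [al <= psi (y m)], and each of
    the [k] terms adds [al]. [psi] is a plain additive function so that it can be [phi] as well as
    [- phi]. *)
Lemma iterated_lim_frequently y psi (K al l : R) k x : 0 < K ->
  (forall u v, psi (u + v) = psi u + psi v) -> (forall u, psi u <= K * N u) ->
  (forall n, exists2 m, (n <= m)%N & al <= psi (y m)) ->
  iterated_lim N y (nseq k 1) x l -> psi x + k%:R * al <= K * l.
Proof.
move=> K0 psiD psiN psif; elim: k x l => [x l ->|k IH x l [g [gl gL]]].
  by rewrite mul0r addr0.
rewrite leNgt; apply/negP => lt.
have : \forall n \near \oo, K * g n < psi x + k.+1%:R * al.
  have : K * g n @[n --> \oo] --> K * l by apply: cvgMr.
  by move=> /cvgr_lt; apply.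
move=> [n0 _ gn]; have [n n0n aln] := psif n0.
have := gn n n0n; have := IH _ _ (gl n).
by rewrite /= scale1r psiD mulrS mulrDl mul1r; lra.
Qed.

(** If [phi (y n) >= e] infinitely often, then [k * e <= K] for every [k], since sums of [k] basis
    vectors of the spreading model have norm 1. *)
Lemma weakly_null_spreading y : 
  (forall k, iterated_lim N y (nseq k.+1 1) 0 1) -> weakly_cvg y 0.
Proof.
move=> yN phi cphi; have [K [K0 Kphi]] := linear_le_norm cphi.
have near_lt psi e : (forall u v, psi (u + v) = psi u + psi v) ->
    (forall u, psi u <= K * N u) -> 0 < e -> \forall n \near \oo, psi (y n) < e.
  move=> psiD psiN e0; apply: contrapT => nf.
  have psif n : exists2 m, (n <= m)%N & e <= psi (y m).
    apply: contrapT => /forall2NP h; apply: nf; exists n => // m /= nm.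
    by have [|/negP] := h m; [move=> []|rewrite -ltNge].
  have psi0 : psi 0 = 0 by have := psiD 0 0; rewrite addr0; lra.
  have h k : k.+1%:R * e <= K.
    by have := iterated_lim_frequently K0 psiD psiN psif (yN k); rewrite psi0 add0r mulr1.
  have [k ke] : exists k : nat, k.+1%:R^-1 < e / K.
    exact: filter_ex (near_infty_natSinv_lt (PosNum (divr_gt0 e0 K0))).
  have := h k; rewrite leNgt => /negP; apply.
  by rewrite -ltr_pdivrMl//; move: ke; rewrite ltr_pdivlMr// mulrC.
rewrite linear0; apply/cvgrPdist_lt => e e0.
have h1 := near_lt phi e (fun u v => linearD phi u v) (fun u => le_trans (ler_norm _) (Kphi u)) e0.
have h2 : \forall n \near \oo, - phi (y n) < e.
  apply: (near_lt (fun u => - phi u)) => // [u v|u]; first by rewrite linearD opprD.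
  by rewrite (le_trans (ler_norm _))// normrN.
near=> n; rewrite sub0r normrN ltr_norml; apply/andP; split.
  by rewrite ltrNl; near: n.
by near: n.
Unshelve. all: by end_near. Qed.

Variables (y : nat -> X) (M C : R).
Hypothesis yM : forall n, `|y n| <= M.
Hypothesis cN : clip C N.

(** The ultrafilter is free, so each index can be taken beyond the preceding ones, and a bound along
    increasing lists passes to the iterated limit. *)
Lemma iter_ushift_ge J a x c :
  (forall s, size s = size a -> increasing_from J s ->
    c <= N (x + \sum_(q <- zip a s) q.1 *: y q.2)) ->
  c <= iter_ushift y a N x.
Proof.
elim: a J x => [|a l IH] J x h.
  by have := h [::] erefl isT; rewrite big_nil addr0.
apply: (cvgr_to_ge (ushift_cvg yM (iter_ushift_clip yM l cN))).
have : \forall n \near free_ultra, (J <= n)%N by apply: free_ultra_oo; exists J.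
apply: filterS => n Jn; apply: (IH n.+1) => s sl sn.
have := h (n :: s); rewrite /= sl big_cons addrA; apply=> //.
by rewrite Jn.
Qed.

Lemma iter_ushift_le J a x c :
  (forall s, size s = size a -> increasing_from J s ->
    N (x + \sum_(q <- zip a s) q.1 *: y q.2) <= c) ->
  iter_ushift y a N x <= c.
Proof.
elim: a J x => [|a l IH] J x h.
  by have := h [::] erefl isT; rewrite big_nil addr0.
apply: (cvgr_to_le (ushift_cvg yM (iter_ushift_clip yM l cN))).
have : \forall n \near free_ultra, (J <= n)%N by apply: free_ultra_oo; exists J.
apply: filterS => n Jn; apply: (IH n.+1) => s sl sn.
have := h (n :: s); rewrite /= sl big_cons addrA; apply=> //.
by rewrite Jn.
Qed.

(** Excludes norm convergence: the spreading models constructed below give $e_1 - e_2$ a nonzero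
    norm, whereas a convergent sequence gives it norm 0. *)
Lemma cvgn_iterated_lim l : cvgn y -> iterated_lim N y [:: 1; -1] 0 l -> l = 0.
Proof.
move=> yc /(iterated_lim_ushift cN) ->; set z := limn y.
have cvgN x : N (x - y n) @[n --> \oo] --> N (x - z).
  apply/cvgrPdist_le => e e0; have C1 : 0 < `|C| + 1 by rewrite ltr_wpDl.
  have : \forall n \near \oo, `|z - y n| <= e / (`|C| + 1).
    by have /cvgrPdist_le := yc; apply; rewrite divr_gt0.
  apply: filterS => n; rewrite ler_pdivlMr// => h.
  apply: (le_trans (clip_norm _ _ cN)); rewrite opprD addrACA subrr add0r.
  rewrite opprK addrC -normrN opprB (le_trans _ h)// mulrC ler_wpM2l//.
  by rewrite (le_trans (ler_norm _))// lerDl.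
rewrite /= /ushift; apply: ulimE.
have -> : (fun n => ulim (fun m => N (0 + 1 *: y n + -1 *: y m))) = (fun n => N (y n - z)).
  apply/funext => n; apply: ulimE; apply: cvgn_ultra.
  by under eq_fun do rewrite add0r scale1r scaleN1r; exact: cvgN.
apply: cvgn_ultra; have := cvgN z; rewrite subrr (sublinear0 (equivalent_norm_sublinear N_norm)).
have NN x : N (- x) = N x by have [_ NZ _ _] := N_norm; rewrite -scaleN1r NZ normrN1 mul1r.
by under eq_fun do rewrite -NN opprB.
Qed.

End SpreadingModels.

Lemma c00_basis_sum (R : realType) n (a : nat -> R) :
  \sum_(i < n) a i *: c00_basis R i = Poly (mkseq a n).
Proof.
rewrite -poly_def; apply/polyP => k; rewrite coef_poly coef_Poly.
by case: ltnP => kn; [rewrite nth_mkseq|rewrite nth_default// size_mkseq].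
Qed.

(** The first vectors give [1 <= A] and [1 <= B]; with [A * B <= 1] both constants are 1. *)
Lemma K_equivalent1 (R : realType) (U V : lmodType R) (NU : U -> R) (NV : V -> R) u v :
  K_equivalent 1 NU u NV v -> NU (u 0) = 1 -> NV (v 0) = 1 ->
  forall n (a : nat -> R), NU (\sum_(i < n) a i *: u i) = NV (\sum_(i < n) a i *: v i).
Proof.
move=> [A [B [A0 B0 AB h]]] u0 v0 n a.
have := h 1 (fun=> 1); rewrite !big_ord1 !scale1r u0 v0 !mulr1 => /andP[A1 B1].
have {}A1 : 1 <= A by rewrite -[A]invrK -invr1 lef_pV2 ?posrE ?invr_gt0.
have [Ae Be] : A = 1 /\ B = 1 by split; nra.
have := h n a; rewrite Ae Be invr1 !mul1r => hn.
by apply/eqP; rewrite eq_le.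
Qed.

(** * (2) implies (3): the norms of sums of two basis vectors *)

Section SpreadingPairs.
Variables (R : realType) (X : normedModType R) (N : X -> R).
Hypothesis N_norm : equivalent_norm N.
Variables (y : nat -> X) (f : c00 R -> R).
Hypothesis yN : normalized N y.
Hypothesis yf : spreading_model N y f.

Lemma spreading_model_basis0 : f (c00_basis R 0) = 1.
Proof.
have [C cN] := equivalent_norm_clip N_norm; have [_ _ _ yl] := yf.
have /(iterated_lim_ushift cN) := yl (mkseq (fun=> 1) 1).
rewrite -c00_basis_sum big_ord1 scale1r => ->; apply: ulimE.
have -> : (fun n => iter_ushift y [::] N (0 + 1 *: y n)) = (fun=> 1).
  by apply/funext => n; rewrite /= add0r scale1r yN.
exact: cvg_cst.
Qed.

Lemma l1_spreading_pair :
  K_equivalent 1 f (c00_basis R) (fun a : l1 R => `|a|) (@l1_basis R) ->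
  f (c00_basis R 0 + c00_basis R 1) = 2 /\ f (c00_basis R 0 - c00_basis R 1) = 2.
Proof.
move=> /K_equivalent1/(_ spreading_model_basis0 (norm_l1_basis R 0)) fE.
split.
  have := fE 2%N (fun=> 1); rewrite (l1_norm_sum 2 (fun=> 1)) !big_ord_recl !big_ord0 !scale1r.
  by rewrite normr1 !addr0 => ->.
have := fE 2%N (fun i => if i is 0%N then 1 else -1).
rewrite (l1_norm_sum 2 (fun i => if i is 0%N then 1 else -1)).
rewrite !big_ord_recl !big_ord0 /= scale1r scaleN1r.
by rewrite normrN normr1 !addr0 => ->.
Qed.

Lemma norm_c0_sum1 k : `|\sum_(i < k.+1) 1 *: c0_basis R i| = 1.
Proof.
apply/eqP; rewrite eq_le; apply/andP; split.
  by apply: c0_norm_le => i; rewrite (c0_sumE k.+1 (fun=> 1)); case: ifP; rewrite ?normr1 ?normr0.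
have := c0_norm_ge (\sum_(i < k.+1) 1 *: c0_basis R i) 0.
by rewrite (c0_sumE k.+1 (fun=> 1)) normr1.
Qed.

(** Weak nullness is not part of (2); it follows because all sums of distinct basis vectors have
    norm 1. *)
Lemma c0_spreading_pair :
  K_equivalent 1 f (c00_basis R) (fun a : c0 R => `|a|) (@c0_basis R) ->
  weakly_cvg y 0 /\ f (c00_basis R 0 + c00_basis R 1) = 1.
Proof.
move=> /K_equivalent1/(_ spreading_model_basis0 (norm_c0_basis R 0)) fE.
split; last first.
  have := fE 2%N (fun=> 1); rewrite norm_c0_sum1 !big_ord_recl !big_ord0 !scale1r.
  by rewrite !addr0.
have [_ _ _ yl] := yf.
apply: (weakly_null_spreading N_norm) => k; have := yl (mkseq (fun=> 1) k.+1).
rewrite -c00_basis_sum (fE k.+1 (fun=> 1)) norm_c0_sum1.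
rewrite (_ : mkseq (fun=> 1) k.+1 = nseq k.+1 1)// /mkseq.
by elim: k.+1 0%N => //= n IH i; rewrite IH.
Qed.

End SpreadingPairs.

(** * (3) implies (1): the hypothesis applied to the symmetric renorming *)

Section FromSpreadingPairs.
Variables (R : realType) (X : completeNormedModType R).
Hypothesis sepX : separable X.

Lemma spreading_pair_contains_l1 : (forall N : X -> R, equivalent_norm N ->
    exists (y : nat -> X) (f : c00 R -> R),
      [/\ normalized N y, spreading_model N y f,
          f (c00_basis R 0 + c00_basis R 1) = 2 &
          f (c00_basis R 0 - c00_basis R 1) = 2]) -> contains_isomorphic X (l1 R).
Proof.
have [d dd] := dense_sequence sepX; have [N N_norm Nd] := symmetric_renorming d.
move=> /(_ N N_norm)[y [f [yN [_ _ _ yl] f1 f2]]].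
have [C cN] := equivalent_norm_clip N_norm.
have [M yM] := normalized_bounded N_norm yN.
have e1 := iterated_lim_ushift cN (yl (mkseq (fun=> 1) 2)).
rewrite -c00_basis_sum !big_ord_recl big_ord0 !scale1r addr0 f1 in e1.
have e2 := iterated_lim_ushift cN (yl (mkseq (fun i => if i is 0%N then 1 else -1) 2)).
rewrite -c00_basis_sum !big_ord_recl big_ord0 scale1r scaleN1r addr0 f2 in e2.
have yN1 n : N (y n) = 1 by exact: yN.
have l1k := l1_tail_norm2_ge yM N_norm Nd dd yN1 (esym e1) (esym e2).
have T0 := tail_norm_gt0 yM N_norm yN1.
have [m [A [A0 hA]]] := l1_basic_sequence yM T0 l1k.
by apply: (@l1_contains R X (y \o m) A M) => // n; exact: yM.
Qed.

Lemma spreading_pair_contains_c0 : (forall N : X -> R, equivalent_norm N ->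
    exists (y : nat -> X) (f : c00 R -> R),
      [/\ normalized N y, weakly_cvg y 0, spreading_model N y f &
          f (c00_basis R 0 + c00_basis R 1) = 1]) -> contains_isomorphic X (c0 R).
Proof.
have [d dd] := dense_sequence sepX; have [N N_norm Nd] := symmetric_renorming d.
move=> /(_ N N_norm)[y [f [yN y0 [_ _ _ yl] f1]]].
have [C cN] := equivalent_norm_clip N_norm.
have [M yM] := normalized_bounded N_norm yN.
have e1 := iterated_lim_ushift cN (yl (mkseq (fun=> 1) 2)).
rewrite -c00_basis_sum !big_ord_recl big_ord0 !scale1r addr0 f1 in e1.
have yN1 n : N (y n) = 1 by exact: yN.
have c0k := c0_tail_norm2_le yM N_norm Nd dd yN1 (esym e1) y0.
have T0 := tail_norm_gt0 yM N_norm yN1.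
have [m [A [B [A0 B0 hAB]]]] := c0_basic_sequence yM T0 y0 c0k.
exact: (@c0_contains R X (y \o m) A B).
Qed.

End FromSpreadingPairs.

(** * (1) implies (2): spreading models isometric to l1 and c0 *)

Lemma increasing_from_iota J k : increasing_from J (iota J k).
Proof. by elim: k J => //= k IH J; rewrite leqnn IH. Qed.

Lemma increasing_from_map (m : nat -> nat) J s : (forall j, (m j < m j.+1)%N) ->
  increasing_from J s -> increasing_from J (map m s).
Proof.
move=> mS; have jm j : (j <= m j)%N by elim: j => // j IH; exact: leq_ltn_trans (mS j).
have mm : {homo m : i j / (i <= j)%N} by apply: (homo_leq leqnn leq_trans) => i; exact: ltnW.
suff h J' : (J' <= m J)%N -> increasing_from J s -> increasing_from J' (map m s).
  exact: h.
elim: s J J' => //= h s IH J J' JJ' /andP[Jh hs].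
by rewrite (leq_trans JJ' (mm _ _ Jh)) (IH h.+1).
Qed.

Lemma le_of_scaled (R : realType) (S t : R) : 0 <= S ->
  (forall e, 0 < e <= 1 -> (1 - e) * S <= t) -> S <= t.
Proof.
move=> S0 h; apply/ler_addgt0Pr => e e0; have S1 : 0 < S + 1 by lra.
pose d := Num.min 1 (e / (S + 1)).
have d0 : 0 < d by rewrite lt_min ltr01 divr_gt0.
have dS : d * S <= e.
  apply: (@le_trans _ _ (d * (S + 1))); first by rewrite ler_wpM2l ?(ltW d0)// lerDl.
  by rewrite -ler_pdivlMr// ge_min lexx orbT.
by have := h d; rewrite d0 ge_min lexx/= => /(_ isT); lra.
Qed.

Lemma ge_of_scaled (R : realType) (S t : R) : 0 <= S ->
  (forall e, 0 < e <= 1 -> t <= (1 + e) * S) -> t <= S.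
Proof.
move=> S0 h; have := @le_of_scaled R S (2 * S - t) S0.
suff : (forall e, 0 < e <= 1 -> (1 - e) * S <= 2 * S - t) by move=> /[swap]/[apply]; lra.
by move=> e /h; lra.
Qed.

Section ToSpreadingModels.
Variables (R : realType) (X : normedModType R) (N : X -> R).
Hypothesis N_norm : equivalent_norm N.

Lemma sum_maxn (V : lmodType R) (a b : nat -> R) (v : nat -> V) k k' :
  \sum_(i < k) a i *: v i + \sum_(i < k') b i *: v i =
  \sum_(i < maxn k k') ((if (i < k)%N then a i else 0) +
    (if (i < k')%N then b i else 0)) *: v i.
Proof.
rewrite (big_ord_widen _ (fun i => a i *: v i) (leq_maxl k k')).
rewrite (big_ord_widen _ (fun i => b i *: v i) (leq_maxr k k')).
rewrite big_mkcond [X in _ + X]big_mkcond -big_split; apply: eq_bigr => i _ /=.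
by rewrite scalerDl; congr (_ + _); case: ifP; rewrite ?scale0r.
Qed.

(* Some functional takes the values 1 and -1 alternately along a tail of y. *)
Lemma l1_not_weakly_cvg (y : nat -> X) J x :
  (forall l, increasing_from J (map snd l) ->
    2^-1 * \sum_(q <- l) `|q.1| <= N (\sum_(q <- l) q.1 *: y q.2)) ->
  ~ weakly_cvg y x.
Proof.
move=> yJ; pose z i := y (J + i)%N.
have zP k (a : nat -> R) : 2^-1 * \sum_(i < k) `|a i| <= N (\sum_(i < k) a i *: z i).
  have := yJ [seq (a i, (J + i)%N) | i <- iota 0 k].
  rewrite -map_comp (_ : map _ _ = iota J k); last by rewrite -[J in RHS]addn0 iotaDl.
  move=> /(_ (increasing_from_iota _ _)); rewrite !big_map.
  have e (V : nmodType) (F : nat -> V) : \sum_(i <- iota 0 k) F i = \sum_(i < k) F i.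
    by rewrite -(big_mkord xpredT) /index_iota subn0.
  by rewrite !e.
pose sg i : R^o := if odd i then -1 else 1.
(* Constraints asking for the value [sg i] at each [z i]; [K] contains the opposite of each
   constraint, so they act as equalities. By [zP] they are compatible with the bound [2 * N u]. *)
pose K : set (X * R) := [set u | exists k (a : nat -> R),
  u = (\sum_(i < k) a i *: z i, \sum_(i < k) a i *: sg i)].
have [sND sNZ] := equivalent_norm_sublinear N_norm.
have s2N : sublinear (fun u => 2 * N u).
  by split=> [u v|t u t0]; [rewrite -mulrDr ler_wpM2l|rewrite sNZ// mulrCA].
have cK : cone K.
  split; first by exists 0, (fun=> 0); rewrite !big_ord0.
  - move=> _ _ _ _ [k [a [-> ->]]] [k' [b [-> ->]]].
    exists (maxn k k'), (fun i => (if (i < k)%N then a i else 0) +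
      (if (i < k')%N then b i else 0)).
    by rewrite !sum_maxn.
  - move=> _ _ t t0 [k [a [-> ->]]]; exists k, (fun i => t * a i).
    rewrite scaler_sumr [t * _]mulr_sumr; congr pair; apply: eq_bigr => i _.
      by rewrite scalerA.
    by rewrite -[RHS]mulrA.
have Kc c i : K (c *: z i, c * sg i).
  exists i.+1, (fun j => if j == i then c else 0).
  rewrite !big_ord_recr/= eqxx !big1 ?add0r// => j _; by rewrite ltn_eqF// scale0r.
have [|phi [phiN phiK]] := hahn_banach s2N cK.
  move=> _ _ [k [a [-> ->]]].
  have NN u : N (- u) = N u by have [_ NZ _ _] := N_norm; rewrite -scaleN1r NZ normrN1 mul1r.
  have : `|\sum_(i < k) a i *: sg i| <= \sum_(i < k) `|a i|.
    apply: le_trans (ler_norm_sum _ _ _) _; apply: ler_sum => i _.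
    by rewrite normrM /sg; case: ifP; rewrite ?normrN normr1 mulr1.
  rewrite ler_norml => /andP[+ _]; have := zP k a; rewrite NN; lra.
have phiz i : phi (z i) = sg i.
  apply/eqP; rewrite eq_le; apply/andP; split.
    by have := phiK _ _ (Kc 1 i); rewrite scale1r mul1r.
  by have := phiK _ _ (Kc (-1) i); rewrite scaleN1r mulN1r linearN lerN2.
have cphi : continuous phi.
  have [_ _ _ [A [B [_ _ AB]]]] := N_norm.
  apply: (@dominated_continuous _ _ _ (2 * B)) => u; apply: le_trans (phiN u) _.
  by rewrite -mulrA ler_wpM2l//; have /andP[] := AB u.
move=> /(_ phi cphi)/cvgrPdist_lt/(_ 1 ltr01)[n0 _ yn0].
(* The indices [n0.*2] and [n0.*2 + 1] have opposite parities, so [phi x] would be at distance less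
   than 1 from both 1 and -1. *)
have ge i : (n0 <= J + (n0.*2 + i))%N.
  by rewrite addnA (leq_trans _ (leq_addr _ _))// (leq_trans _ (leq_addl _ _))// -addnn leq_addr.
have := yn0 _ (ge 0%N); have := yn0 _ (ge 1%N).
rewrite /= -/(z (n0.*2 + 1)%N) -/(z (n0.*2 + 0)%N) !phiz /sg !oddD odd_double/=.
by rewrite !ltr_norml => /andP[? ?] /andP[? ?]; lra.
Qed.

Hypothesis sepX : separable X.

Lemma spreading_model_exists (v : nat -> X) : normalized N v ->
  exists (m : nat -> nat), (forall j, (m j < m j.+1)%N) /\
    forall a, iterated_lim N (v \o m) a 0 (spreading_norm v N (Poly a)).
Proof.
move=> vN; have [C cN] := equivalent_norm_clip N_norm.
have [M vM] := normalized_bounded N_norm vN.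
have [d dd] := dense_sequence sepX.
have [m [mS mP]] := spreading_subsequence vM cN dd.
by exists m; split=> // a; rewrite spreading_normE.
Qed.

Lemma normalized_bounded_fun (y : nat -> X) : normalized N y -> bounded_fun y.
Proof.
move=> /(normalized_bounded N_norm)[M yM]; exists M; rewrite num_real; split=> // K MK n _.
by rewrite /= (le_trans (yM n))// ltW.
Qed.

(** The triangle inequality gives the upper bound, the distortion estimate for arbitrarily small [e]
    the lower one. The same estimate with [e = 2^-1] rules out weak convergence. *)
Lemma contains_l1_spreading : contains_isomorphic X (l1 R) ->
  exists (y : nat -> X) (f : c00 R -> R),
    [/\ normalized N y, spreading_model N y f &
      K_equivalent 1 f (c00_basis R) (fun a : l1 R => `|a|) (@l1_basis R)].
Proof.
move=> /(l1_distortion N_norm)[v [vN vP]].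
have [m [mS mP]] := spreading_model_exists vN.
have [C cN] := equivalent_norm_clip N_norm.
have [M vM] := normalized_bounded N_norm vN.
have sN0 := sublinear0 (equivalent_norm_sublinear N_norm).
have zipE (a : seq R) (s : seq nat) : size s = size a ->
    \sum_(q <- zip a s) `|q.1| = \sum_(x <- a) `|x|.
  by move=> sa; rewrite -[in RHS](@unzip1_zip _ _ a s) ?sa// big_map.
have fE a : spreading_norm v N (Poly a) = \sum_(x <- a) `|x|.
  rewrite spreading_normE; apply/eqP; rewrite eq_le; apply/andP; split.
    apply: (iter_ushift_le vM cN (J := 0)) => s sa _; rewrite add0r.
    apply: le_trans (equivalent_norm_sum N_norm _ _) _.
    rewrite -(zipE _ _ sa); apply: ler_sum => q _.
    by rewrite vN mulr1.
  apply: le_of_scaled => [|e /vP[J hJ]]; first by rewrite sumr_ge0.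
  apply: (iter_ushift_ge vM cN (J := J)) => s sa sJ.
  by rewrite add0r -(zipE _ _ sa) hJ// -/(unzip2 _) unzip2_zip// sa.
exists (v \o m), (spreading_norm v N); split; first by move=> n; exact: vN.
  split=> //.
  - by apply: normalized_bounded_fun => n; exact: vN.
  - move=> /(cvgn_iterated_lim N_norm cN)/(_ (mP _)); rewrite fE !big_cons big_nil.
    by rewrite normrN normr1; lra.
  - move=> [x _]; have [|J hJ] := vP 2^-1; first by lra.
    apply: (@l1_not_weakly_cvg _ J) => l lJ.
    have := hJ [seq (q.1, m q.2) | q <- l]; rewrite !big_map.
    rewrite (_ : map snd _ = map m (map snd l)); last by rewrite -!map_comp.
    rewrite (_ : 1 - 2^-1 = 2^-1 :> R); last by lra.
    by apply; exact: increasing_from_map.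
exists 1, 1; split=> // n a.
rewrite c00_basis_sum fE l1_norm_sum invr1 !mul1r big_map -(big_mkord xpredT (fun i => `|a i|)).
by rewrite /index_iota subn0 lexx.
Qed.

Lemma zip_mkseq_sum (v : nat -> X) n (b : nat -> R) s : size s = n ->
  \sum_(q <- zip (mkseq b n) s) q.1 *: v q.2 = \sum_(i < n) b i *: v (nth 0%N s i).
Proof.
move=> sn; rewrite (big_nth (0, 0%N)) size_zip size_mkseq sn minnn big_mkord.
by apply: eq_bigr => i _; rewrite nth_zip ?size_mkseq//= nth_mkseq.
Qed.

(** Distortion gives the upper bound, and the lower one is deduced from it by changes of sign. The
    norms of sums of basis vectors then make the subsequence weakly null, which excludes a nonzero
    weak limit. *)
Lemma contains_c0_spreading : contains_isomorphic X (c0 R) ->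
  exists (y : nat -> X) (f : c00 R -> R),
    [/\ normalized N y, spreading_model N y f &
      K_equivalent 1 f (c00_basis R) (fun a : c0 R => `|a|) (@c0_basis R)].
Proof.
move=> /(c0_distortion N_norm)[v [vN vP]].
have [m [mS mP]] := spreading_model_exists vN.
have [C cN] := equivalent_norm_clip N_norm.
have [M vM] := normalized_bounded N_norm vN.
have sN := equivalent_norm_sublinear N_norm.
have fE n (a : nat -> R) : spreading_norm v N (Poly (mkseq a n)) =
    `|\sum_(i < n) a i *: c0_basis R i|.
  rewrite spreading_normE; set mu := `|_|.
  have amu i : (i < n)%N -> `|a i| <= mu.
    by move=> ni; have := c0_norm_ge (\sum_(i < n) a i *: c0_basis R i) i; rewrite c0_sumE ni.
  have mem_mu b s q : size s = n -> (forall i, (i < n)%N -> `|b i| <= mu) ->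
      q \in zip (mkseq b n) s -> `|q.1| <= mu.
    move=> sn bmu qz; have : q.1 \in mkseq b n.
      by rewrite -(@unzip1_zip _ _ (mkseq b n) s) ?size_mkseq ?sn//; exact: map_f.
    by move=> /mapP[i]; rewrite mem_iota => /andP[_ ni] ->; exact: bmu.
  have incr b s J : size s = n -> increasing_from J s ->
      increasing_from J (map snd (zip (mkseq b n) s)).
    by move=> sn sJ; rewrite -/(unzip2 _) unzip2_zip// size_mkseq sn.
  apply/eqP; rewrite eq_le; apply/andP; split.
    apply: ge_of_scaled => [|e /vP[J hJ]]; first exact: normr_ge0.
    apply: (iter_ushift_le vM cN (J := J)) => s; rewrite size_mkseq add0r => sn sJ.
    by apply: hJ; [exact: normr_ge0|exact: incr|move=> q; exact: mem_mu].
  case: (posnP n) => [n0|n0].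
    rewrite n0 /= (sublinear0 sN) /mu big1 ?normr0// => i; have := ltn_ord i.
    by rewrite {2}n0.
  have [j aj] := c0_norm_attained a n0.
  apply: le_of_scaled => [|e /vP[J hJ]]; first exact: normr_ge0.
  apply: (iter_ushift_ge vM cN (J := J)) => s; rewrite size_mkseq add0r => sn sJ.
  pose b i := if i == j :> nat then a i else - a i.
  have bmu i : (i < n)%N -> `|b i| <= mu.
    by rewrite /b; case: eqP => _ /amu//; rewrite normrN.
  have h1 : N (\sum_(q <- zip (mkseq b n) s) q.1 *: v q.2) <= (1 + e) * mu.
    by apply: hJ; [exact: normr_ge0|exact: incr|move=> q; exact: mem_mu].
  (* Adding the sum with all signs but one flipped isolates one term. *)
  have h2 : N (\sum_(q <- zip (mkseq a n) s) q.1 *: v q.2 +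
      \sum_(q <- zip (mkseq b n) s) q.1 *: v q.2) = 2 * mu.
    rewrite !zip_mkseq_sum// -big_split/= (bigD1 j)//= big1 => [|i ij].
      rewrite addr0 /b eqxx -scalerDl; have [_ -> _ _] := N_norm.
      by rewrite vN mulr1 -mulr2n normrMn aj mulr_natl.
    by rewrite /b (negbTE (_ : i != j :> nat))// -scalerDl subrr scale0r.
  have := sN.1 (\sum_(q <- zip (mkseq a n) s) q.1 *: v q.2)
    (\sum_(q <- zip (mkseq b n) s) q.1 *: v q.2).
  by rewrite h2; lra.
have y0 : weakly_cvg (v \o m) 0.
  apply: (weakly_null_spreading N_norm) => k; have := mP (mkseq (fun=> 1) k.+1).
  rewrite fE norm_c0_sum1 (_ : mkseq (fun=> 1) k.+1 = nseq k.+1 1)// /mkseq.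
  by elim: k.+1 0%N => //= n IH i; rewrite IH.
exists (v \o m), (spreading_norm v N); split; first by move=> n; exact: vN.
  split=> //.
  - by apply: normalized_bounded_fun => n; exact: vN.
  - pose a i : R := if i is 0%N then 1 else -1.
    move=> /(cvgn_iterated_lim N_norm cN)/(_ (mP (mkseq a 2))); rewrite fE => e0.
    have := c0_norm_ge (\sum_(i < 2) a i *: c0_basis R i) 0.
    by rewrite c0_sumE normr1 [c0_norm _]e0; lra.
  - move=> [x x0 yx]; have sn : sublinear (fun z : X => `|z|).
      by split=> [u w|t u t0]; [exact: ler_normD|rewrite normrZ ger0_norm].
    have [phi [phile phix]] := norming_functional x sn.
    have cphi : continuous phi by apply: (@dominated_continuous _ _ _ 1) => z; rewrite mul1r.
    have : phi x = phi 0 by apply: cvg_unique (yx phi cphi) (y0 phi cphi) => //.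
    by rewrite phix linear0 => /eqP; rewrite normr_eq0 (negbTE x0).
exists 1, 1; split=> // n a.
by rewrite c00_basis_sum fE invr1 !mul1r lexx.
Qed.

End ToSpreadingModels.

Theorem corollary3p3 (R : realType) (X : completeNormedModType R)
    (sepX : separable X) :
  [<-> contains_isomorphic X (l1 R);
       forall N : X -> R, equivalent_norm N ->
         exists (y : nat -> X) (f : c00 R -> R),
           [/\ normalized N y, spreading_model N y f &
               K_equivalent 1 f (c00_basis R)
                 (fun a : l1 R => `|a|) (@l1_basis R)];
       forall N : X -> R, equivalent_norm N ->
         exists (y : nat -> X) (f : c00 R -> R),
           [/\ normalized N y, spreading_model N y f,
               f (c00_basis R 0 + c00_basis R 1) = 2 &
               f (c00_basis R 0 - c00_basis R 1) = 2]] /\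
  [<-> contains_isomorphic X (c0 R);
       forall N : X -> R, equivalent_norm N ->
         exists (y : nat -> X) (f : c00 R -> R),
           [/\ normalized N y, spreading_model N y f &
               K_equivalent 1 f (c00_basis R)
                 (fun a : c0 R => `|a|) (@c0_basis R)];
       forall N : X -> R, equivalent_norm N ->
         exists (y : nat -> X) (f : c00 R -> R),
           [/\ normalized N y, weakly_cvg y 0, spreading_model N y f &
               f (c00_basis R 0 + c00_basis R 1) = 1]].
Proof.
split; tfae.
- by move=> X1 N N_norm; exact: contains_l1_spreading.
- move=> X2 N N_norm; have [y [f [yN yf yl1]]] := X2 N N_norm.
  have [f1 f2] := l1_spreading_pair N_norm yN yf yl1.
  by exists y, f.
- exact: spreading_pair_contains_l1.
- by move=> X1 N N_norm; exact: contains_c0_spreading.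
- move=> X2 N N_norm; have [y [f [yN yf yc0]]] := X2 N N_norm.
  have [y0 f1] := c0_spreading_pair N_norm yN yf yc0.
  by exists y, f.
- exact: spreading_pair_contains_c0.
Qed.
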